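(* For $\theta\in(0,1)\cup(1,2)$ the power space $\mathcal{H}_\theta(\Omega)$ is the real $2$-interpolation space between $\mathcal{H}(\Omega)$ and $L_2(\Omega)$ or $T(L_2(\Omega))$, i.e., $$\mathcal{H}_\theta(\Omega)=\begin{cases}(L_2(\Omega),\mathcal{H}(\Omega))_{\theta,2}, & 0<\theta<1,\\ (\mathcal{H}(\Omega),T(L_2(\Omega)))_{\theta-1,2}, & 1<\theta<2,\end{cases}$$ with equivalence of norms.
   Context: $\Omega\subset\mathbb{R}^d$, $k\colon\Omega\times\Omega\to\mathbb{R}$ is a positive semi-definite kernel, and $\mathcal{H}(\Omega)$ is its reproducing kernel Hilbert space. $L_2(\Omega)$ is with respect to the Lebesgue measure. Standing assumption (Mercer): $(Tf)(x):=\int_\Omega k(x,y)f(y)\,\mathrm{d}y$ defines a linear integral operator $T\colon L_2(\Omega)\to L_2(\Omega)$ with countably many $L_2(\Omega)$-orthonormal eigenfunctions $\{\varphi_j\}_{j=1}^\infty$ and positive eigenvalues $\{\lambda_j\}_{j=1}^\infty$ such that $\{\lambda_j^{1/2}\varphi_j\}_{j=1}^\infty$ is an orthonormal basis of $\mathcal{H}(\Omega)$; every $f\in L_2(\Omega)$ satisfies $f=\sum_j\langle f,\varphi_j\rangle_{L_2(\Omega)}\varphi_j$. Power spaces: for $\theta\ge0$, $\mathcal{H}_\theta(\Omega):=\{f=\sum_j\langle f,\varphi_j\rangle_{L_2(\Omega)}\varphi_j:\ \|f\|^2_{\mathcal{H}_\theta(\Omega)}:=\sum_j\lambda_j^{-\theta}|\langle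 f,\varphi_j\rangle_{L_2(\Omega)}|^2<\infty\}$. One has $\mathcal{H}_0(\Omega)=L_2(\Omega)$, $\mathcal{H}_1(\Omega)=\mathcal{H}(\Omega)$, $\mathcal{H}_2(\Omega)=T(L_2(\Omega))$, and $T(L_2(\Omega))$ carries the norm of $\mathcal{H}_2(\Omega)$, i.e. $\|Tg\|_{T(L_2(\Omega))}=\|g\|_{L_2(\Omega)}$. Real interpolation: for a Hilbert space $H$, a Banach space $\mathcal{K}\subset H$, $f\in H$ and $t>0$, set $K(t,f):=\inf_{v\in\mathcal{K}}(\|f-v\|_H+t\|v\|_{\mathcal{K}})$. For $\zeta\in(0,1)$, $\|f\|_{\zeta,2}:=\big(\int_0^\infty |t^{-\zeta}K(t,f)|^2\,\frac{\mathrm{d}t}{t}\big)^{1/2}$ and $(H,\mathcal{K})_{\zeta,2}:=\{f\in H:\|f\|_{\zeta,2}<\infty\}$. *)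

(* Defs.v *)
From HB Require Import structures.
From mathcomp Require Import all_boot all_order all_algebra.
From mathcomp Require Import all_classical all_reals all_analysis.

Set Implicit Arguments.
Unset Strict Implicit.
Unset Printing Implicit Defensive.

Import Order.TTheory GRing.Theory Num.Theory.
Import numFieldNormedType.Exports.

Local Open Scope classical_set_scope.
Local Open Scope ring_scope.

Section cover_outer_measure.
Local Open Scope ereal_scope.
Context {R : realType} {T I : Type} (s : I -> set T) (v : I -> \bar R).

Definition cover_inf (X : set T) : \bar R :=
  ereal_inf [set \sum_(n <oo) v (F n) | F in
    [set F : nat -> I | X `<=` \bigcup_n s (F n)]].

Hypothesis v_ge0 : forall i, 0 <= v i.

Lemma cover_inf_ge0 X : 0 <= cover_inf X.
Proof.
by apply: le_ereal_inf_tmp => _ [F _ <-]; exact: nneseries_ge0.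
Qed.

Lemma le_cover_inf : {homo cover_inf : A B / A `<=` B >-> A <= B}.
Proof.
move=> A B AB; apply/ereal_inf_le_tmp => _ [F BF <-].
by exists F => //; exact: subset_trans BF.
Qed.

Lemma cover_inf0 i0 : v i0 = 0 -> cover_inf set0 = 0.
Proof.
move=> v0; apply/eqP; rewrite eq_le cover_inf_ge0 andbT.
apply: ereal_inf_lbound; exists (fun=> i0) => //=.
by rewrite eseries0.
Qed.

Lemma cover_inf_sigma_subadditive : sigma_subadditive cover_inf.
Proof.
move=> A; have [[i ioo]|] := pselect (exists i, cover_inf (A i) = +oo).
  rewrite (eseries_pinfty _ _ ioo) ?leey// => n _.
  by rewrite -ltNye (lt_le_trans _ (cover_inf_ge0 _)).
rewrite -forallNE => Aoo.
suff add2e (e : {posnum R}) :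
    cover_inf (\bigcup_n A n) <= \sum_(i <oo) cover_inf (A i) + e%:num%:E.
  by apply/lee_addgt0Pr => _/posnumP[].
rewrite (le_trans _ (epsilon_trick _ _ _))//; last first.
  by move=> n; exact: cover_inf_ge0.
pose P n (B : nat -> I) := A n `<=` \bigcup_k s (B k) /\
  \sum_(k <oo) v (B k) <= cover_inf (A n) + (e%:num / (2 ^ n.+1)%:R)%:E.
have [G PG] : {G : nat -> nat -> I & forall n, P n (G n)}.
  apply: (@choice _ _ P) => n; rewrite /P /cover_inf.
  set S := (X in ereal_inf X); move infS : (ereal_inf S) => iS.
  case: iS infS => [r Sr|Soo|Soo].
  - have en1 : (0 < e%:num / (2 ^ n.+1)%:R)%R by [].
    have /(lb_ereal_inf_adherent en1) : ereal_inf S \is a fin_num by rewrite Sr.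
    move=> [x [B AnB muBx] xS].
    by exists B; split => //; rewrite muBx -Sr; exact/ltW.
  - by have := Aoo n; rewrite /cover_inf Soo.
  - have := cover_inf_ge0 (A n).
    by rewrite /cover_inf Soo.
have muG_ge0 x : 0 <= (v \o uncurry G) x by exact: v_ge0.
apply: (@le_trans _ _ (\esum_(i in setT) (v \o uncurry G) i)).
  apply: ereal_inf_lbound => /=.
  have /card_esym/ppcard_eqP[f] := card_nat2.
  exists (uncurry G \o f).
    apply: (@subset_trans _ (\bigcup_n \bigcup_k s (G n k))) => [t [i _]|].
      by move=> /(PG i).1 -[j _ ?]; exists i => //; exists j.
    move=> t [i _ [j _ Bijt]]; exists (f^-1%FUN (i, j)) => //=.
    by rewrite invK ?inE.
  rewrite -(esum_pred_image (v \o uncurry G) _ xpredT) ?[fun=> _]set_true//.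
  by rewrite image_eq.
rewrite (_ : esum _ _ = \sum_(i <oo) \sum_(j <oo ) v (G i j)); last first.
  pose J : nat -> set (nat * nat) := fun i => [set (i, j) | j in setT].
  rewrite (_ : setT = \bigcup_k J k); last first.
    by rewrite predeqE => -[a b]; split => // _; exists a => //; exists b.
  rewrite esum_bigcupT /=; last 2 first.
    - apply/trivIsetP => i j _ _ ij.
      rewrite predeqE => -[n m] /=; split => //= -[] [_] _ [<-{n} _].
      by move=> [m' _] [] /esym/eqP; rewrite (negbTE ij).
    - by move=> /= [n m]; exact: v_ge0.
  rewrite -(image_id [set: nat]) -fun_true esum_pred_image//; last first.
    by move=> n _; exact: esum_ge0.
  apply: eq_eseriesr => /= j _.
  rewrite -(esum_pred_image (v \o uncurry G) (pair j) predT)//=; last first.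
    by move=> ? ? _ _; exact: (@can_inj _ _ _ snd).
  by congr esum; rewrite predeqE => -[a b]; split; move=> [i _ <-]; exists i.
apply: lee_lim.
- apply: is_cvg_nneseries => n *.
  by apply: nneseries_ge0 => m *; exact: (muG_ge0 (n, m)).
- by apply: is_cvg_nneseries => n *; apply: adde_ge0 => //; exact: cover_inf_ge0.
- by near=> n; apply: lee_sum => i _; exact: (PG i).2.
Unshelve. all: by end_near. Qed.

End cover_outer_measure.

Section lebesgue_Rd.
Context {R : realType} {d : nat}.

(* [None] stands for the empty set, so that finite covers are allowed also
   when d = 0. *)
Definition box (ab : option ('rV[R]_d * 'rV[R]_d)) : set 'rV[R]_d :=
  if ab is Some (a, b) then [set x | forall i, a 0 i <= x 0 i <= b 0 i]
  else set0.

Definition box_volume (ab : option ('rV[R]_d * 'rV[R]_d)) : \bar R :=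
  if ab is Some (a, b) then (\prod_i Num.max 0 (b 0 i - a 0 i))%:E else 0%E.

Definition lebesgue_outer : set 'rV[R]_d -> \bar R := cover_inf box box_volume.

Lemma box_volume_ge0 ab : (0 <= box_volume ab)%E.
Proof.
case: ab => [[a b]|]//=; rewrite lee_fin prodr_ge0// => i _.
by rewrite le_max lexx.
Qed.

Let lebesgue_outer0 : lebesgue_outer set0 = 0%E.
Proof. exact: (@cover_inf0 _ _ _ box _ box_volume_ge0 None). Qed.

Let lebesgue_outer_ge0 X : (0 <= lebesgue_outer X)%E.
Proof. exact: (cover_inf_ge0 _ box_volume_ge0). Qed.

Let le_lebesgue_outer :
  {homo lebesgue_outer : A B / A `<=` B >-> (A <= B)%E}.
Proof. exact: le_cover_inf. Qed.

Let lebesgue_outer_sigma_subadditive : sigma_subadditive lebesgue_outer.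
Proof. exact: (cover_inf_sigma_subadditive _ box_volume_ge0). Qed.

HB.instance Definition _ := isOuterMeasure.Build R 'rV[R]_d lebesgue_outer
  lebesgue_outer0 lebesgue_outer_ge0 le_lebesgue_outer
  lebesgue_outer_sigma_subadditive.

End lebesgue_Rd.
Arguments lebesgue_outer R d : clear implicits.

Definition lebesgue_outer_measure (R : realType) (d : nat) :
  {outer_measure set 'rV[R]_d -> \bar R} := lebesgue_outer R d.

(* R^d with the sigma-algebra of all Lebesgue measurable sets, in which every
   null set is measurable. *)
Notation Rd R d := (caratheodory_type (lebesgue_outer_measure R d)).

Definition lebesgue_Rd (R : realType) (d : nat) :
    {measure set (Rd R d) -> \bar R} :=
  lebesgue_outer_measure R d : set (Rd R d) -> \bar R.

(* A real function on Om is encoded as a function on the ambient type that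
   vanishes outside Om, so that f \_ Om encodes the restriction of f to Om. *)

Section L2.
Context {dsp : measure_display} {T : measurableType dsp} {R : realType}.
Variables (mu : {measure set T -> \bar R}) (Om : set T).

(* Elements are functions, not classes: equality in L_2(Om) is _ = _ %[ae mu]. *)
Definition L2 : set (T -> R) :=
  [set f | f \in Lfun mu 2%:E /\ f = f \_ Om].

Definition L2ip (f g : T -> R) : R := \int[mu]_(x in Om) (f x * g x).

Definition L2norm (f : T -> R) : R := fine ('N[mu]_2%:E[EFin \o f]).

End L2.

Section kernel.
Context {T : Type} {R : realType} (Om : set T).

Definition psd_kernel (k : T -> T -> R) : Prop :=
  (forall x y, Om x -> Om y -> k x y = k y x) /\
  forall (n : nat) (x : 'I_n -> T) (c : 'I_n -> R), (forall i, Om (x i)) ->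
    0 <= \sum_(i < n) \sum_(j < n) c i * c j * k (x i) (x j).

Definition ip_norm (ip : (T -> R) -> (T -> R) -> R) (f : T -> R) : R :=
  Num.sqrt (ip f f).

(* The Hilbert space of functions on Om with carrier H, inner product ip and
   reproducing kernel k; it is determined by k (Moore-Aronszajn), the values of
   ip outside H being irrelevant. *)
Record is_RKHS (k : T -> T -> R) (H : set (T -> R))
    (ip : (T -> R) -> (T -> R) -> R) : Prop := {
  rkhs_dom : forall f, H f -> f = f \_ Om ;
  rkhs0 : H 0 ;
  rkhs_lin : forall a f g, H f -> H g -> H (a *: f + g) ;
  rkhs_ipC : forall f g, H f -> H g -> ip f g = ip g f ;
  rkhs_ip_lin : forall a f g h, H f -> H g -> H h ->
    ip (a *: f + g) h = a * ip f h + ip g h ;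
  rkhs_ip_ge0 : forall f, H f -> 0 <= ip f f ;
  rkhs_ip_eq0 : forall f, H f -> ip f f = 0 -> f = 0 ;
  rkhs_complete : forall u : nat -> T -> R, (forall n, H (u n)) ->
    (forall e, 0 < e -> exists N : nat, forall m n : nat,
      (N <= m)%N -> (N <= n)%N -> ip_norm ip (u m - u n) < e) ->
    exists2 f, H f & ip_norm ip (u n - f) @[n --> \oo] --> (0 : R) ;
  rkhs_kernel : forall x, Om x -> H (k x \_ Om) ;
  rkhs_reproducing : forall f x, H f -> Om x -> ip f (k x \_ Om) = f x }.

Definition is_orthonormal_basis (H : set (T -> R))
    (ip : (T -> R) -> (T -> R) -> R) (e : nat -> T -> R) : Prop :=
  [/\ forall j, H (e j),
      forall i j, ip (e i) (e j) = (i == j)%:R &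
      forall f, H f ->
        ip_norm ip (f - \sum_(j < n) ip f (e j) *: e j) @[n --> \oo]
          --> (0 : R)].

End kernel.

Section mercer.
Context {dsp : measure_display} {T : measurableType dsp} {R : realType}.
Variables (mu : {measure set T -> \bar R}) (Om : set T).

Definition integral_op (k : T -> T -> R) (f : T -> R) : T -> R :=
  (fun x => \int[mu]_(y in Om) (k x y * f y)) \_ Om.

Record mercer (k : T -> T -> R) (H : set (T -> R))
    (ip : (T -> R) -> (T -> R) -> R)
    (phi : nat -> T -> R) (lam : nat -> R) : Prop := {
  mercer_integrable : forall f, L2 mu Om f -> {ae mu, forall x, Om x ->
    mu.-integrable Om (EFin \o (fun y => k x y * f y))} ;
  mercer_L2 : forall f, L2 mu Om f -> L2 mu Om (integral_op k f) ;
  mercer_phi_L2 : forall j, L2 mu Om (phi j) ;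
  mercer_phi_orthonormal : forall i j,
    L2ip mu Om (phi i) (phi j) = (i == j)%:R ;
  mercer_lam_gt0 : forall j, 0 < lam j ;
  mercer_eigen : forall j,
    integral_op k (phi j) = lam j *: phi j %[ae mu] ;
  mercer_basis :
    is_orthonormal_basis H ip (fun j => Num.sqrt (lam j) *: phi j) ;
  mercer_expansion : forall f, L2 mu Om f ->
    L2norm mu (f - \sum_(j < n) L2ip mu Om f (phi j) *: phi j) @[n --> \oo]
      --> (0 : R) }.

Section power_space.
Variables (phi : nat -> T -> R) (lam : nat -> R) (theta : R).

Definition power_sqnorm (f : T -> R) : \bar R :=
  (\sum_(j <oo) (lam j `^ (- theta) * `|L2ip mu Om f (phi j)| ^+ 2)%:E)%E.

Definition power_space : set (T -> R) :=
  [set f | L2 mu Om f /\ (power_sqnorm f < +oo)%E].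

Definition power_norm (f : T -> R) : R := Num.sqrt (fine (power_sqnorm f)).

End power_space.

(* The classes in L_2(Om) of the functions S g, g in G, normed by the norm of
   the preimage; the infimum deals with the choice of g, which is unique when S
   is injective modulo null sets. The RKHS (S = id) and T(L_2(Om)) are viewed in
   this way as subspaces of L_2(Om). *)
Definition image_space (S : (T -> R) -> T -> R) (G : set (T -> R)) :
    set (T -> R) :=
  [set f | L2 mu Om f /\ exists2 g, G g & f = S g %[ae mu]].

Definition image_norm (S : (T -> R) -> T -> R) (G : set (T -> R))
    (normG : (T -> R) -> R) (f : T -> R) : R :=
  inf [set normG g | g in [set g | G g /\ f = S g %[ae mu]]].

Definition rkhs_space (H : set (T -> R)) : set (T -> R) := image_space id H.

Definition rkhs_norm (H : set (T -> R)) (ip : (T -> R) -> (T -> R) -> R) :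
    (T -> R) -> R :=
  image_norm id H (ip_norm ip).

Definition range_space (k : T -> T -> R) : set (T -> R) :=
  image_space (integral_op k) (L2 mu Om).

Definition range_norm (k : T -> T -> R) : (T -> R) -> R :=
  image_norm (integral_op k) (L2 mu Om) (L2norm mu).

End mercer.

Section interpolation.
Context {V : zmodType} {R : realType}.
Variables (H : set V) (normH : V -> R) (K : set V) (normK : V -> R).

Definition K_functional (t : R) (f : V) : R :=
  inf [set normH (f - v) + t * normK v | v in K].

Definition interp_sqnorm (zeta : R) (f : V) : \bar R :=
  (\int[@lebesgue_measure R]_(t in `]0%R, +oo[)
    (`|t `^ (- zeta) * K_functional t f| ^+ 2 / t)%:E)%E.

Definition interp_space (zeta : R) : set V :=
  [set f | H f /\ (interp_sqnorm zeta f < +oo)%E].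

Definition interp_norm (zeta : R) (f : V) : R :=
  Num.sqrt (fine (interp_sqnorm zeta f)).

End interpolation.

Definition equal_with_equivalent_norms {V : Type} {R : realType}
    (A : set V) (normA : V -> R) (B : set V) (normB : V -> R) : Prop :=
  A = B /\
  exists c C : R, [/\ 0 < c, 0 < C &
    forall f, A f -> c * normA f <= normB f /\ normB f <= C * normA f].

(* Main.v *)
Require Import Defs.
From HB Require Import structures.
From mathcomp Require Import all_boot all_order all_algebra.
From mathcomp Require Import all_classical all_reals all_analysis.
From mathcomp Require Import measurable_realfun.
From mathcomp Require Import ring lra.

Import Order.TTheory GRing.Theory Num.Theory.
Import numFieldNormedType.Exports.

Set Implicit Arguments.
Unset Strict Implicit.
Unset Printing Implicit Defensive.

Local Open Scope classical_set_scope.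
Local Open Scope ring_scope.

(* The eigenvalues are bounded: otherwise choose 4^n < lam (j n); the functions
   g_c = \sum_n c_n 2^-n phi_(j n), c in {0,1}^nat, are dominated by one function
   of L_2, hence c |-> |T g_c|^2 is lower semicontinuous (dominated convergence,
   then Fatou), and flipping c_n changes T g_c by 2^-n lam_(j n) phi_(j n), so
   that it is unbounded on every cylinder; by Baire's argument it is infinite
   somewhere. With bounded eigenvalues T acts diagonally on coefficients, and L_2,
   the RKHS and T(L_2) are the weighted sequence spaces with weights 1, lam^-1
   and lam^-2.
   For weights w and w / lam, put m_j(t) = min(1, t^2 / lam_j). Then K(t, f)^2 is
   comparable to \sum_j w_j m_j(t) f_j^2: every competitor v satisfies
   (f_j - v_j)^2 + t^2 / lam_j v_j^2 >= m_j(t) f_j^2 / 2, and the finite sums of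
   the f_j phi_j with t^2 <= lam_j almost attain the bound. Integrating against
   t^(-2 zeta - 1) dt gives the weights w_j lam_j^-zeta up to constants. *)

(** * Semi-inner products *)

(** [mercer] does not state that T is continuous, that the eigenvalues are bounded, that the RKHS
    lies in L_2, or that k is jointly measurable. Hence neither a series nor a second integral can
    simply be moved through T. What it does give is that [k x] times a function of L_2 is integrable
    for almost every x; applied to one dominating h, this makes T u_n converge almost everywhere
    along dominated sequences. Limits are therefore taken in three moves: thin out a norm convergent
    sequence until a single function of L_2 dominates it, pass to the limit pointwise, and return to
    L_2 by Fatou's lemma. The RKHS enters L_2 by the same return, since norm convergence there
    implies pointwise convergence. Baire's argument plays the part of the closed graph theorem.
    Elements of L_2 are functions and not classes, so the algebra shared by L_2 and the RKHS is done
    for a form that may vanish on nonzero elements. *)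

Record semi_inner {R : realType} {V : lmodType R} (A : set V) (ip : V -> V -> R) : Prop := {
  si_0 : A 0 ;
  si_lin : forall a f g, A f -> A g -> A (a *: f + g) ;
  si_C : forall f g, A f -> A g -> ip f g = ip g f ;
  si_ip_lin : forall a f g h, A f -> A g -> A h ->
    ip (a *: f + g) h = a * ip f h + ip g h ;
  si_ge0 : forall f, A f -> 0 <= ip f f }.

Definition psum {R : realType} {V : lmodType R} (e : nat -> V) (b : nat -> R) n : V :=
  \sum_(j < n) b j *: e j.

Section SemiInner.
Context {R : realType} {V : lmodType R} {A : set V} {ip : V -> V -> R}.
Hypothesis hA : semi_inner A ip.

Lemma siD f g : A f -> A g -> A (f + g).
Proof. by move=> Af Ag; rewrite -[f]scale1r; apply: (si_lin hA). Qed.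

Lemma siZ a f : A f -> A (a *: f).
Proof. by move=> Af; rewrite -[a *: f]addr0; apply: (si_lin hA) => //; exact: (si_0 hA). Qed.

Lemma siB f g : A f -> A g -> A (f - g).
Proof. by move=> Af Ag; apply: siD => //; rewrite -scaleN1r; exact: siZ. Qed.

Lemma si_sum (I : Type) (s : seq I) P (F : I -> V) :
  (forall i, A (F i)) -> A (\sum_(i <- s | P i) F i).
Proof.
move=> AF; apply: (big_ind A); [exact: (si_0 hA)|exact: siD|by move=> i _; exact: AF].
Qed.

Lemma si_ipDl f g h : A f -> A g -> A h -> ip (f + g) h = ip f h + ip g h.
Proof. by move=> Af Ag Ah; rewrite -[f in LHS]scale1r (si_ip_lin hA)// mul1r. Qed.

Lemma si_ip0l h : A h -> ip 0 h = 0.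
Proof.
move=> Ah; have := @si_ipDl 0 0 h (si_0 hA) (si_0 hA) Ah.
by rewrite addr0 => /eqP; rewrite -subr_eq0 opprD addNKr oppr_eq0 => /eqP.
Qed.

Lemma si_ipZl a f h : A f -> A h -> ip (a *: f) h = a * ip f h.
Proof.
move=> Af Ah; rewrite -[_ *: _]addr0 (si_ip_lin hA)//; last exact: (si_0 hA).
by rewrite si_ip0l// addr0.
Qed.

Lemma si_ipBl f g h : A f -> A g -> A h -> ip (f - g) h = ip f h - ip g h.
Proof.
move=> Af Ag Ah; rewrite -scaleN1r si_ipDl//; last exact: siZ.
by rewrite si_ipZl// mulN1r.
Qed.

Lemma si_ip_suml (I : Type) (s : seq I) P (F : I -> V) h :
  (forall i, A (F i)) -> A h ->
  ip (\sum_(i <- s | P i) F i) h = \sum_(i <- s | P i) ip (F i) h.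
Proof.
move=> AF Ah; apply: (@proj2 (A (\sum_(i <- s | P i) F i))).
apply: (big_ind2 (fun x y => A x /\ ip x h = y)).
- by split; [exact: (si_0 hA)|exact: si_ip0l].
- by move=> x1 x2 y1 y2 [Ax <-] [Ay <-]; split; [exact: siD|rewrite si_ipDl].
- by move=> i _; split.
Qed.

Lemma si_ipB f g : A f -> A g -> ip (f - g) (f - g) = ip f f - 2 * ip f g + ip g g.
Proof.
move=> Af Ag; rewrite si_ipBl//; last exact: siB.
rewrite (si_C hA)//; last exact: siB.
rewrite [ip g _](si_C hA)//; last exact: siB.
by rewrite !si_ipBl// (si_C hA Ag Af); ring.
Qed.

(** The right side minus the left side is the square of f + g. *)
Lemma si_ipB_le f g : A f -> A g -> ip (f - g) (f - g) <= 2 * (ip f f + ip g g).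
Proof.
move=> Af Ag; have := si_ge0 hA (siB Af (siZ (-1) Ag)).
rewrite !si_ipB//; last exact: siZ.
rewrite si_ipZl//; last exact: siZ.
rewrite ![ip _ (-1 *: g)](si_C hA)//; try exact: siZ.
by rewrite !si_ipZl// (si_C hA Ag Af) => h; lra.
Qed.

Lemma si_cauchy_schwarz f g : A f -> A g -> ip f g ^+ 2 <= ip f f * ip g g.
Proof.
move=> Af Ag.
have h t : 0 <= ip f f - 2 * t * ip f g + t ^+ 2 * ip g g.
  have At := siZ t Ag; have := si_ge0 hA (siB Af At).
  rewrite si_ipB// si_ipZl// [ip f (_ *: _)](si_C hA)// si_ipZl// [ip g (_ *: _)](si_C hA)//.
  rewrite si_ipZl// [ip g f](si_C hA)//.
  by have -> : ip f f - 2 * (t * ip f g) + t * (t * ip g g) =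
    ip f f - 2 * t * ip f g + t ^+ 2 * ip g g by ring.
have := si_ge0 hA Ag; rewrite le_eqVlt => /predU1P[g0|g0]; last first.
  have := h (ip f g / ip g g).
  rewrite -(pmulr_lge0 _ g0) => {h}.
  suff -> : (ip f f - 2 * (ip f g / ip g g) * ip f g + (ip f g / ip g g) ^+ 2 * ip g g) * ip g g
     = ip f f * ip g g - ip f g ^+ 2 by rewrite subr_ge0.
  by field; rewrite gt_eqF.
rewrite -g0 mulr0; have [->|fg0] := eqVneq (ip f g) 0; first by rewrite expr0n.
(* A nonzero g may have [ip g g = 0]. Then the quadratic in [h] is affine in t, and this t gives it
   the value -1. *)
have := h ((ip f f + 1) / (2 * ip f g)); rewrite -g0 mulr0 addr0.
suff -> : ip f f - 2 * ((ip f f + 1) / (2 * ip f g)) * ip f g = -1.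
  by rewrite lerNr oppr0 ler10.
by field.
Qed.

Context {e : nat -> V}.
Hypothesis eA : forall j, A (e j).
Hypothesis eo : forall i j, ip (e i) (e j) = (i == j)%:R.

Lemma si_psum b n : A (psum e b n).
Proof. by apply: si_sum => i; exact: siZ. Qed.

Lemma si_ip_psum b n j : ip (psum e b n) (e j) = if (j < n)%N then b j else 0.
Proof.
rewrite si_ip_suml//; last by move=> i; exact: siZ.
under eq_bigr do rewrite si_ipZl// eo.
case: ifPn => jn.
  rewrite (bigD1 (Ordinal jn))//= eqxx mulr1 big1 ?addr0// => i ij.
  by rewrite (_ : _ == _ = false) ?mulr0//; apply: contraNF ij => /eqP ij; apply/eqP/val_inj.
by rewrite big1// => i _; rewrite (_ : _ == _ = false) ?mulr0//; apply: contraNF jn => /eqP <-.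
Qed.

Lemma si_ip_psumr f b n : A f -> ip f (psum e b n) = \sum_(j < n) b j * ip f (e j).
Proof.
move=> Af; rewrite (si_C hA)//; last exact: si_psum.
rewrite si_ip_suml//; last by move=> i; exact: siZ.
by apply: eq_bigr => i _; rewrite si_ipZl// (si_C hA).
Qed.

Lemma si_sqr_psum b n : ip (psum e b n) (psum e b n) = \sum_(j < n) b j ^+ 2.
Proof.
rewrite si_ip_psumr; last exact: si_psum.
by apply: eq_bigr => i _; rewrite si_ip_psum ltn_ord expr2.
Qed.

Lemma si_sqr_sub_psum f n (S := psum e (fun j => ip f (e j)) n) : A f ->
  ip (f - S) (f - S) = ip f f - \sum_(j < n) ip f (e j) ^+ 2.
Proof.
move=> Af; rewrite si_ipB//; last exact: si_psum.
rewrite si_ip_psumr// si_sqr_psum.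
under eq_bigr do rewrite -expr2.
ring.
Qed.

Lemma si_bessel f n : A f -> \sum_(j < n) ip f (e j) ^+ 2 <= ip f f.
Proof.
move=> Af; rewrite -subr_ge0 -si_sqr_sub_psum//; apply: (si_ge0 hA).
by apply: siB => //; exact: si_psum.
Qed.

Lemma si_sqr_psumB b m n : (m <= n)%N ->
  ip (psum e b n - psum e b m) (psum e b n - psum e b m) =
  \sum_(j < n) b j ^+ 2 - \sum_(j < m) b j ^+ 2.
Proof.
move=> mn; rewrite si_ipB; [|exact: si_psum..].
rewrite [ip (psum e b n) (psum e b m)]si_ip_psumr; last exact: si_psum.
have -> : \sum_(j < m) b j * ip (psum e b n) (e j) = \sum_(j < m) b j ^+ 2.
  by apply: eq_bigr => i _; rewrite si_ip_psum (leq_trans _ mn)// expr2.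
by rewrite !si_sqr_psum; ring.
Qed.

Lemma parseval f : A f ->
  Num.sqrt (ip (f - psum e (fun j => ip f (e j)) n)
               (f - psum e (fun j => ip f (e j)) n)) @[n --> \oo] --> (0 : R) ->
  (\sum_(j <oo) (ip f (e j) ^+ 2)%:E = (ip f f)%:E)%E.
Proof.
move=> Af /= cv; apply/cvg_lim => //.
under eq_fun do rewrite big_mkord sumEFin.
apply: cvg_EFin; first exact: nearW.
pose d n := f - psum e (fun j => ip f (e j)) n.
rewrite (_ : _ \o _ = fun n => ip f f - Num.sqrt (ip (d n) (d n)) * Num.sqrt (ip (d n) (d n))).
  rewrite -[X in _ --> X]subr0 -[X in _ - X](mulr0 0).
  by apply: cvgB; [exact: cvg_cst|exact: cvgM].
apply/funext => n /=; rewrite -expr2 sqr_sqrtr; last first.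
  by apply: (si_ge0 hA); apply: siB => //; exact: si_psum.
by rewrite si_sqr_sub_psum// opprB addrC subrK.
Qed.

End SemiInner.

Lemma cvg_nneseries_fin {R : realType} (b : nat -> R) : (forall j, 0 <= b j) ->
  (\sum_(j <oo) (b j)%:E < +oo)%E ->
  exists2 M : R, (\sum_(j <oo) (b j)%:E = M%:E)%E &
  \sum_(j < n) b j @[n --> \oo] --> M.
Proof.
move=> b0 fin; have s0 : (0 <= \sum_(j <oo) (b j)%:E)%E.
  by apply: nneseries_ge0 => j _ _; rewrite lee_fin.
have sE : (\sum_(j <oo) (b j)%:E)%E = (fine (\sum_(j <oo) (b j)%:E)%E)%:E.
  by rewrite fineK// ge0_fin_numE.
exists (fine (\sum_(j <oo) (b j)%:E)%E) => //.
have : (fun n => \sum_(0 <= j < n) (b j)%:E)%E @ \oo --> (\sum_(j <oo) (b j)%:E)%E.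
  by apply: is_cvg_nneseries => j _ _; rewrite lee_fin.
rewrite sE => /fine_cvgP[_].
apply: cvg_trans; apply: near_eq_cvg; apply: nearW => n /=.
by rewrite sumEFin big_mkord.
Qed.

(** * The space L_2 *)

Section L2Space.
Context {dsp : measure_display} {T : measurableType dsp} {R : realType}.
Context {mu : {measure set T -> \bar R}} {Om : set T}.
Hypothesis mOm : measurable Om.
Local Notation L2 := (L2 mu Om).
Local Notation ip := (L2ip mu Om).

Lemma Lnorm2E (f : T -> R) :
  ('N[mu]_2%:E[EFin \o f])%E = ((\int[mu]_x ((f x) ^+ 2)%:E) `^ 2^-1)%E.
Proof.
rewrite unlock /=. congr poweR; apply: eq_integral => x _ /=.
by rewrite powR_mulrn// real_normK// num_real.
Qed.

Lemma L2P (f : T -> R) : L2 f <->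
  [/\ measurable_fun setT f, (\int[mu]_x ((f x) ^+ 2)%:E < +oo)%E & f = f \_ Om].
Proof.
have f0 : (0 <= \int[mu]_x ((f x) ^+ 2)%:E)%E.
  by apply: integral_ge0 => x _; rewrite lee_fin sqr_ge0.
split=> [[fL fO]|[mf fL fO]].
  have /Lfun2_integrable_sqr/integrableP[_ fi] := fL.
  move: fL; rewrite inE => /andP[]; rewrite inE/= => mf _.
  split => //; apply: le_lt_trans fi; rewrite le_eqVlt; apply/orP; left; apply/eqP.
  by apply: eq_integral => x _ /=; rewrite ger0_norm// sqr_ge0.
split => //; rewrite inE; apply/andP; split; rewrite inE//= /finite_norm Lnorm2E.
by apply: poweR_lty.
Qed.

Lemma L2_mf (f : T -> R) : L2 f -> measurable_fun setT f. Proof. by move=> /L2P[]. Qed.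
Lemma L2_restrict (f : T -> R) : L2 f -> f = f \_ Om. Proof. by move=> /L2P[]. Qed.
Lemma L2_lty (f : T -> R) : L2 f -> (\int[mu]_x ((f x) ^+ 2)%:E < +oo)%E. Proof. by move=> /L2P[]. Qed.

Lemma L2_out (f : T -> R) x : f = f \_ Om -> ~ Om x -> f x = 0.
Proof. by move=> -> Ox; rewrite patchE memNset. Qed.

Lemma L2ip_integrableT (f g : T -> R) : L2 f -> L2 g -> mu.-integrable setT (fun x => (f x * g x)%:E).
Proof.
by move=> [Lf _] [Lg _]; apply/Lfun1_integrable; exact: Lfun2_mul_Lfun1.
Qed.

Lemma L2ip_integrable (f g : T -> R) : L2 f -> L2 g -> mu.-integrable Om (fun x => (f x * g x)%:E).
Proof.
by move=> Lf Lg; apply: integrableS (L2ip_integrableT Lf Lg).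
Qed.

Lemma L2ip_EFin (f g : T -> R) : L2 f -> L2 g -> ((ip f g)%:E = \int[mu]_(x in Om) (f x * g x)%:E)%E.
Proof.
move=> Lf Lg; rewrite /L2ip /Rintegral fineK//.
by apply: integrable_fin_num => //; exact: L2ip_integrable.
Qed.

Lemma L2sqr (f : T -> R) : L2 f -> (\int[mu]_x ((f x) ^+ 2)%:E)%E = (ip f f)%:E.
Proof.
move=> Lf; rewrite L2ip_EFin// [RHS]integral_mkcond; apply: eq_integral => x _.
rewrite patchE; case: ifPn => [_|]; first by rewrite expr2.
rewrite notin_setE => Ox; rewrite (L2_out _ Ox)//; last exact: L2_restrict.
by rewrite expr0n.
Qed.

Lemma semi_inner_L2 : semi_inner L2 (L2ip mu Om).
Proof.
have lin (a : R) (f g : T -> R) : L2 f -> L2 g -> L2 (a *: f + g).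
  move=> [Lf fO] [Lg gO]; split; last first.
    by rewrite fO gO; apply/funext => x; rewrite !patchE; case: ifP => // h;
      rewrite /= /GRing.add/= /GRing.scale/= !patchE h ?scaler0 ?addr0.
  exact: (Lfun_submod_closed mu (lee1n 2)).2.
split => //.
- apply/L2P; split; first exact: measurable_cst.
    by under eq_integral do rewrite expr0n/=; rewrite integral0.
  by apply/funext => x; rewrite patchE; case: ifP.
- by move=> f g Lf Lg; rewrite /L2ip; under eq_Rintegral do rewrite mulrC.
- move=> a f g h Lf Lg Lh; apply: EFin_inj.
  rewrite EFinD EFinM !L2ip_EFin//; last exact: lin.
  rewrite -integralZl//; last exact: L2ip_integrable.
  rewrite -integralD//; last 2 first.
  - by apply: integrableZl => //; exact: L2ip_integrable.
  - exact: L2ip_integrable.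
  by apply: eq_integral => x _; rewrite -EFinM -EFinD; congr EFin; rewrite mulrA -mulrDl.
- by move=> f Lf; rewrite /L2ip; apply: Rintegral_ge0 => x _; rewrite -expr2 sqr_ge0.
Qed.

Lemma L2normE (f : T -> R) : L2 f -> L2norm mu f = ip_norm (L2ip mu Om) f.
Proof.
move=> Lf; rewrite /L2norm Lnorm2E L2sqr// poweR_EFin/=.
by rewrite powR12_sqrt// (si_ge0 semi_inner_L2).
Qed.

Lemma L2ip_ae (f f' g : T -> R) : L2 f -> L2 f' -> L2 g -> f = f' %[ae mu] -> ip f g = ip f' g.
Proof.
move=> Lf Lf' Lg ff'; apply: EFin_inj; rewrite !L2ip_EFin//.
apply: ae_eq_integral => //.
- by have /integrableP[] := L2ip_integrable Lf Lg.
- by have /integrableP[] := L2ip_integrable Lf' Lg.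
- by apply: filterS ff' => x /(_ I) -> _.
Qed.

Lemma L2ip_ae0 (f : T -> R) : L2 f -> ip f f = 0 -> f = 0 %[ae mu].
Proof.
move=> Lf f0; have := L2sqr Lf; rewrite f0.
have /(ae_eq_integral_abs mu measurableT)[h _] : measurable_fun setT (fun x => (f x ^+ 2)%:E : \bar R).
  by apply/measurable_EFinP; apply: measurable_funX; exact: L2_mf.
have -> : (\int[mu]_x ((f x) ^+ 2)%:E = \int[mu]_x `|((f x) ^+ 2)%:E|)%E.
  by apply: eq_integral => x _; rewrite gee0_abs// lee_fin sqr_ge0.
move=> /h; apply: filterS => x /(_ I) [/eqP] + _.
by rewrite sqrf_eq0 => /eqP.
Qed.

Lemma ae_eq_sub0 (f g : T -> R) : f - g = 0 %[ae mu] -> f = g %[ae mu].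
Proof. by apply: filterS => x /(_ I)/eqP + _; rewrite subr_eq0 => /eqP. Qed.

(** This turns pointwise limits into elements of L_2 and keeps their norm bounds. Measurability of f
    is a hypothesis because [mu] need not be complete, so that an almost everywhere limit of
    measurable functions may fail to be measurable. *)
Lemma L2_fatou (u : nat -> T -> R) (f : T -> R) (M : R) :
  (forall n, L2 (u n)) -> measurable_fun setT f -> f = f \_ Om ->
  {ae mu, forall x, Om x -> u n x @[n --> \oo] --> f x} ->
  (\forall n \near \oo, (ip (u n) (u n)) <= M) -> L2 f /\ (ip f f) <= M.
Proof.
move=> Lu mf fO uf uM.
have sub : (\int[mu]_x ((f x) ^+ 2)%:E <= M%:E)%E.
  have mu2 n : measurable_fun setT (fun x => (u n x ^+ 2)%:E : \bar R).
    by apply/measurable_EFinP; apply: measurable_funX; exact: L2_mf.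
  apply: (@le_trans _ _ (\int[mu]_x limn_einf (fun n => ((u n x) ^+ 2)%:E))%E).
    apply: ae_ge0_le_integral => //.
    - by move=> x _; rewrite lee_fin sqr_ge0.
    - by apply/measurable_EFinP; apply: measurable_funX.
    - move=> x _; rewrite limn_einf_lim; apply: lime_ge; first exact: is_cvg_einfs.
      apply: nearW => n; apply: le_ereal_inf_tmp => _ [k _ <-].
      by rewrite lee_fin sqr_ge0.
    - under eq_fun do rewrite /limn_einf.
      apply: measurableT_comp => //; apply: measurable_fun_limn_esup => n.
      exact: measurableT_comp.
    - apply: filterS uf => x h _; rewrite le_eqVlt; apply/orP; left; apply/eqP/esym.
      apply: (cvg_limn_einf_sup _).1; apply: cvg_EFin; first exact: nearW.
      have [Ox|Ox] := pselect (Om x).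
        by apply: (@cvg_comp _ _ _ _ (fun y => y ^+ 2) _ _ _ (h Ox)); exact: exprn_continuous.
      rewrite (L2_out fO Ox) expr0n/=.
      under eq_fun do rewrite /= (L2_out (L2_restrict (Lu _)) Ox) expr0n/=.
      exact: cvg_cst.
  apply: (le_trans (fatou _ measurableT mu2 _)); first by move=> n x _; rewrite lee_fin sqr_ge0.
  rewrite limn_einf_lim; apply: lime_le; first exact: is_cvg_einfs.
  case: uM => N _ uM; apply: nearW => n.
  (* The bound M holds only from N on, so the infimum over the tail from n is compared with its
     member at [maxn n N]. *)
  apply: (@le_trans _ _ (\int[mu]_x ((u (maxn n N) x) ^+ 2)%:E)%E).
    by apply: ereal_inf_lbound; exists (maxn n N) => //=; rewrite leq_maxl.
  by rewrite L2sqr// lee_fin; apply: uM => /=; rewrite leq_maxr.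
have Lf : L2 f by apply/L2P; split => //; exact: le_lt_trans sub (ltry _).
by split => //; rewrite -lee_fin -L2sqr.
Qed.
End L2Space.

(** * Dominated sequences and integral operators *)

Lemma nneseries_le_bound {R : realType} (b : nat -> R) (M : R) : (forall j, 0 <= b j) ->
  (forall n, \sum_(j < n) b j <= M) -> (\sum_(j <oo) (b j)%:E <= M%:E)%E.
Proof.
move=> b0 bM; apply: lime_le; first by apply: is_cvg_nneseries => j _ _; rewrite lee_fin.
by apply: nearW => n; rewrite sumEFin big_mkord lee_fin.
Qed.

Lemma nneseries_ge_sum {R : realType} (b : nat -> R) n : (forall j, 0 <= b j) ->
  ((\sum_(j < n) b j)%:E <= \sum_(j <oo) (b j)%:E)%E.
Proof.
move=> b0; rewrite -sumEFin -(big_mkord xpredT (fun j => (b j)%:E)).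
by apply: nneseries_lim_ge => j _ _; rewrite lee_fin.
Qed.

(** A Cauchy-Schwarz inequality with the weights 2^-k, whose sum is at most 2. Peeling off the first
    term, it follows from (a + S)^2 <= 2 a^2 + 2 S^2. *)
Lemma sqr_sum_le_geometric {R : realType} (a : nat -> R) n :
  (\sum_(k < n) a k) ^+ 2 <= 2 * \sum_(k < n) 2 ^+ k * a k ^+ 2.
Proof.
elim: n a => [|n IH] a; first by rewrite !big_ord0 expr0n mulr0.
rewrite !big_ord_recl/=; have := IH (fun k => a k.+1).
have -> : \sum_(i < n) 2 ^+ bump 0 i * a (bump 0 i) ^+ 2 =
          2 * \sum_(k < n) 2 ^+ k * a k.+1 ^+ 2.
  by rewrite mulr_sumr; apply: eq_bigr => i _; rewrite /bump leq0n add1n exprS mulrA.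
rewrite /bump/=; set S := (\sum_(i < n) a _); set B := \sum_(k < n) _.
move=> h; have : 0 <= (a 0%N - S) ^+ 2 by exact: sqr_ge0.
by rewrite expr0; nra.
Qed.

Section Dominated.
Context {dsp : measure_display} {T : measurableType dsp} {R : realType}.
Context {mu : {measure set T -> \bar R}} {Om : set T}.
Hypothesis mOm : measurable Om.
Local Notation L2 := (L2 mu Om).
Local Notation ip := (L2ip mu Om).

(** Instead of the sum of the |w_k|, the dominating function is the square root of 2 W with W =
    \sum_k 2^k w_k^2. Its square is a series of nonnegative functions, so monotone convergence alone
    bounds the integral: 2^k times 4^-k is summable, and W has integral at most 2. *)
Lemma L2_dominant (w : nat -> T -> R) : (forall k, L2 (w k)) ->
  (forall k, ip (w k) (w k) <= 4^-1 ^+ k) ->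
  exists h, [/\ L2 h, forall x, 0 <= h x &
   {ae mu, forall x, forall n, \sum_(k < n) `|w k x| <= h x}].
Proof.
move=> Lw w4.
pose W x := (\sum_(k <oo) (2 ^+ k * w k x ^+ 2)%:E)%E.
have W0 x : (0 <= W x)%E.
  by apply: nneseries_ge0 => k _ _; rewrite lee_fin mulr_ge0// sqr_ge0.
have mw k : measurable_fun setT (fun x => (2 ^+ k * w k x ^+ 2)%:E : \bar R).
  apply/measurable_EFinP; apply: measurable_funM => //.
  by apply: measurable_funX; exact: L2_mf.
have mW : measurable_fun setT W.
  by apply: ge0_emeasurable_sum => [k x _ _|k _] //; rewrite lee_fin mulr_ge0// sqr_ge0.
have iW : (\int[mu]_x W x <= 2%:E)%E.
  rewrite /W integral_nneseries//; last first.
    by move=> k x _; rewrite lee_fin mulr_ge0// sqr_ge0.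
  have E k : (\int[mu]_x (2 ^+ k * w k x ^+ 2)%:E = (2 ^+ k * ip (w k) (w k))%:E)%E.
    under eq_integral do rewrite EFinM.
    rewrite ge0_integralZl_EFin//; first by rewrite (L2sqr mOm).
    - by move=> x _; rewrite lee_fin sqr_ge0.
    - by apply/measurable_EFinP; apply: measurable_funX; exact: L2_mf.
  under eq_eseriesr do rewrite E.
  apply: nneseries_le_bound => [k|n].
    by rewrite mulr_ge0// (si_ge0 (semi_inner_L2 mOm)).
  apply: (@le_trans _ _ (series (geometric 1 2^-1) n)).
    rewrite /series/= big_mkord; apply: ler_sum => k _.
    apply: (@le_trans _ _ (2 ^+ k * 4^-1 ^+ k)); first by rewrite ler_wpM2l.
    by rewrite -exprMn mul1r (_ : 2 * 4^-1 = 2^-1 :> R)//; field.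
  have := @geometric_le_lim R n 1 2^-1; have -> : 1 / (1 - 2^-1) = 2 :> R by field.
  by apply => //; rewrite ger0_norm// invf_lt1// ltr1n.
have fW : {ae mu, forall x, W x \is a fin_num}.
  have : mu.-integrable setT W.
    apply/integrableP; split => //; under eq_integral do rewrite gee0_abs//.
    exact: le_lt_trans iW (ltry _).
  by move/(integrable_ae measurableT); apply: filterS => x; exact.
(* Where W is infinite [fine] returns 0, so h is finite everywhere; the domination is lost only on
   this null set. *)
pose h x := Num.sqrt (2 * fine (W x)).
have h2 x : h x ^+ 2 = 2 * fine (W x).
  by rewrite sqr_sqrtr// mulr_ge0// fine_ge0.
exists h; split; last 2 first.
- by move=> x; exact: sqrtr_ge0.
- apply: filterS fW => x fWx n.
  rewrite -ler_sqr ?nnegrE ?sqrtr_ge0//; last exact: sumr_ge0.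
  rewrite h2 (le_trans (sqr_sum_le_geometric (fun k => `|w k x|) n))//.
  rewrite ler_wpM2l// -lee_fin fineK//.
  under eq_bigr do rewrite real_normK ?num_real//.
  by apply: nneseries_ge_sum => k; rewrite mulr_ge0// sqr_ge0.
apply/L2P => //; split.
- apply: (@measurableT_comp _ _ _ _ _ _ (@Num.sqrt R) _ (fun x => 2 * fine (W x))).
    by apply: continuous_measurable_fun; exact: sqrt_continuous.
  by apply: measurable_funM => //; apply: measurableT_comp.
- apply: (@le_lt_trans _ _ (\int[mu]_x (2%:E * W x))%E); last first.
    rewrite ge0_integralZl_EFin//; apply: (@le_lt_trans _ _ (2%:E * 2%:E)%E); last exact: ltry.
    exact: lee_wpmul2l.
  apply: ae_ge0_le_integral => //.
  + by move=> x _; rewrite lee_fin sqr_ge0.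
  + under eq_fun do rewrite h2.
    apply/measurable_EFinP; apply: measurable_funM => //; apply: measurableT_comp => //.
  + by move=> x _; apply: mule_ge0.
  + exact: measurable_funeM.
  + by apply: filterS fW => x fWx _; rewrite h2 EFinM fineK.
- apply/funext => x; rewrite patchE; case: ifPn => //; rewrite notin_setE => Ox.
  rewrite /h (_ : W x = 0%E) ?mulr0 ?sqrtr0//.
  apply: eseries0 => k _ _; rewrite (L2_out (L2_restrict (Lw k)) Ox).
  by rewrite expr0n mulr0.
Qed.

Lemma L2_dominated_limit (u : nat -> T -> R) (h : T -> R) :
  (forall n, L2 (u n)) -> L2 h ->
  {ae mu, forall x, forall n, `|u n x| <= h x} ->
  {ae mu, forall x, cvgn (u ^~ x)} ->
  exists g, L2 g /\ {ae mu, forall x, (forall n, `|u n x| <= h x) /\ u n x @[n --> \oo] --> g x}.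
Proof.
move=> Lu Lh dom cv.
have [N [mN N0 subN]] : {ae mu, forall x, (forall n, `|u n x| <= h x) /\ cvgn (u ^~ x)}.
  by apply: filterS2 dom cv.
have {}subN x : ~ N x -> (forall n, `|u n x| <= h x) /\ cvgn (u ^~ x).
  by move=> Nx; apply: contrapT => Px; apply: Nx; exact: subN.
pose v n := u n \_ (~` N).
pose g x := limn (v ^~ x).
have vg x : v n x @[n --> \oo] --> g x.
  rewrite /g /v; have [Nx|Nx] := pselect (N x).
    rewrite (_ : (fun n => (u n \_ (~` N)) x) = cst 0); first exact: is_cvg_cst.
    by apply/funext => n; rewrite patchE memNset//; exact.
  rewrite (_ : (fun n => (u n \_ (~` N)) x) = u ^~ x); first exact: (subN _ Nx).2.
  by apply/funext => n; rewrite patchE mem_set.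
have mv n : measurable_fun setT (v n).
  by apply/(measurable_restrictT _ (measurableC mN)).1; apply: measurable_funTS; exact: L2_mf.
have mg : measurable_fun setT g by apply: (measurable_fun_cvg mv) => x _; exact: vg.
have gE x : ~ N x -> u n x @[n --> \oo] --> g x.
  move=> Nx; have := vg x.
  by rewrite /v (_ : (fun n => (u n \_ (~` N)) x) = u ^~ x)//; apply/funext => n; rewrite patchE mem_set.
exists g; split; last first.
  exists N; split => // x; apply: contra_notP => Nx.
  by have [? ?] := subN _ Nx; split => //; exact: gE.
apply/L2P; split => //.
- apply: le_lt_trans (L2_lty Lh); apply: ae_ge0_le_integral => //.
  + by move=> x _; rewrite lee_fin sqr_ge0.
  + by apply/measurable_EFinP; apply: measurable_funX.
  + by move=> x _; rewrite lee_fin sqr_ge0.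
  + by apply/measurable_EFinP; apply: measurable_funX; exact: (L2_mf Lh).
  + exists N; split => // x; apply: contra_notP => Nx _.
    rewrite lee_fin; have [hx _] := subN _ Nx.
    have gh : `|g x| <= h x.
      have cg : `|u n x| @[n --> \oo] --> `|g x| by apply: cvg_norm; exact: gE.
      have /cvg_lim <- := cg; last exact: Rhausdorff.
      by apply: limr_le; [apply/cvg_ex; exists (`|g x|)|apply: nearW].
    by rewrite -real_normK ?num_real// ler_sqr// nnegrE// (le_trans _ gh).
- apply/funext => x; rewrite patchE; case: ifPn => //; rewrite notin_setE => Ox.
  rewrite /g (_ : v ^~ x = cst 0) ?lim_cst//.
  by apply/funext => n; rewrite /v patchE; case: ifP => // _; rewrite (L2_out (L2_restrict (Lu n)) Ox).
Qed.
End Dominated.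

Section IntegralOperator.
Context {dsp : measure_display} {T : measurableType dsp} {R : realType}.
Context {mu : {measure set T -> \bar R}} {Om : set T} {k : T -> T -> R}.
Hypothesis mOm : measurable Om.
Local Notation L2 := (L2 mu Om).
Local Notation S := (integral_op mu Om k).
Hypothesis int_k : forall f, L2 f -> {ae mu, forall x, Om x ->
    mu.-integrable Om (EFin \o (fun y => k x y * f y))}.

(** For fixed x this is dominated convergence in y with bound |k x y * h y|, which is integrable for
    almost every x because h itself lies in L_2. The exceptional sets of x, one for each function of
    the sequence, are countably many. *)
Lemma integral_op_dominated (u : nat -> T -> R) (f h : T -> R) :
  (forall n, L2 (u n)) -> L2 f -> L2 h ->
  {ae mu, forall x, forall n, `|u n x| <= h x} ->
  {ae mu, forall x, u n x @[n --> \oo] --> f x} ->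
  {ae mu, forall x, S (u n) x @[n --> \oo] --> S f x}.
Proof.
move=> Lu Lf Lh dom cv.
have iu := ae_foralln (fun n => int_k (Lu n)).
apply: filterS3 (int_k Lf) (int_k Lh) iu => x ixf ixh ixu.
have [Ox|Ox] := pselect (Om x); last first.
  rewrite /integral_op patchE memNset//.
  by under eq_fun do rewrite patchE memNset//; exact: cvg_cst.
rewrite /integral_op patchE mem_set//; under eq_fun do rewrite patchE mem_set//.
have iu' n := ixu n Ox.
apply: fine_cvg; rewrite fineK; last exact: integrable_fin_num (ixf Ox).
have [|||||_ _] := @dominated_convergence _ _ _ mu _ mOm
  (fun n y => (k x y * u n y)%:E) (fun y => (k x y * f y)%:E) (fun y => `|k x y * h y|%:E).
- by move=> n; have /integrableP[] := iu' n.
- by have /integrableP[] := ixf Ox.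
- apply: filterS cv => y uy Oy; apply: cvg_EFin; first exact: nearW.
  by apply: cvgM => //; exact: cvg_cst.
- by have := integrable_abse (ixh Ox).
- apply: filterS dom => y uy n Oy; rewrite lee_fin !normrM ler_wpM2l//.
  exact: le_trans (uy n) (ler_norm _).
by [].
Qed.

(** The identity is only almost everywhere: where an integrand is not integrable, the value of the
    integral is a default and additivity may fail. *)
Lemma integral_op_lin (a : R) (f g : T -> R) : L2 f -> L2 g ->
  S (a *: f + g) = a *: S f + S g %[ae mu].
Proof.
move=> Lf Lg; apply: filterS2 (int_k Lf) (int_k Lg) => x ixf ixg _.
rewrite /integral_op patchE /= /GRing.add/= /GRing.scale/= !patchE.
case: ifPn => [/set_mem Ox|_]; last by rewrite scaler0 addr0.
have {}ixf := ixf Ox; have {}ixg := ixg Ox.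
rewrite -[_ *: _]/(a * _) -RintegralZl// -RintegralD//; last first.
  by have := integrableZl mOm a ixf.
by apply: eq_Rintegral => y _; rewrite mulrDr; congr (_ + _); rewrite mulrCA.
Qed.

Lemma integral_opZ (a : R) (f : T -> R) : L2 f -> S (a *: f) = a *: S f %[ae mu].
Proof.
move=> Lf; apply: filterS (int_k Lf) => x ixf _.
rewrite /integral_op patchE /= /GRing.scale/= !patchE.
case: ifPn => [/set_mem Ox|_]; last by rewrite scaler0.
rewrite -[_ *: _]/(a * _) -RintegralZl//; last exact: ixf.
by apply: eq_Rintegral => y _; rewrite mulrCA.
Qed.
End IntegralOperator.

(** * Boundedness of the eigenvalues *)

(** Baire's theorem in the Cantor space {0,1}^nat: by the first hypothesis the sets {Q > r} are
    open, by the second they are dense. A point common to all {Q > n} is impossible, as Q has real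
    values. *)
Lemma cantor_baire {R : realType} (Q : (nat -> bool) -> R) :
  (forall r (c : nat -> bool) (c_ : nat -> nat -> bool),
    (forall n i, (i < n)%N -> c_ n i = c i) -> (forall n, Q (c_ n) <= r) -> Q c <= r) ->
  (forall r (c : nat -> bool) N, exists2 c', (forall i, (i < N)%N -> c' i = c i) & r < Q c') ->
  False.
Proof.
move=> lsc unb.
(* A pair (c, N) stands for the cylinder of the sequences that agree with c below N. Each cylinder
   contains a strictly smaller one on which Q > r. *)
have step (rc : nat * ((nat -> bool) * nat)) : exists c' : (nat -> bool) * nat,
    [/\ (rc.2.2 < c'.2)%N, forall i, (i < rc.2.2)%N -> c'.1 i = rc.2.1 i &
      forall c'', (forall i, (i < c'.2)%N -> c'' i = c'.1 i) -> rc.1%:R < Q c''].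
  case: rc => r [c N] /=; have [c' c'c rQ] := unb r%:R c N.
  (* If no such M existed, every M would give a sequence agreeing with c' below M with Q <= r, and
     semicontinuity would force Q c' <= r. *)
  suff [M MQ] : exists M, forall c'', (forall i, (i < M)%N -> c'' i = c' i) -> r%:R < Q c''.
    exists (c', maxn M N.+1); split => //=; first by rewrite leq_max leqnn orbT.
    by move=> c'' h; apply: MQ => i iM; apply: h; rewrite leq_max iM.
  apply: contrapT => /forallNP h.
  have /choice[c_ c_P] : forall M, exists c'', (forall i, (i < M)%N -> c'' i = c' i) /\ Q c'' <= r%:R.
    move=> M; have /existsNP[c'' /not_implyP[? /negP]] := h M.
    by rewrite -leNgt => ?; exists c''.
  have := lsc r%:R c' c_ (fun n => (c_P n).1) (fun n => (c_P n).2).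
  by rewrite leNgt rQ.
have /choice[F FP] := step.
pose s := fix s n := if n is m.+1 then F (m, s m) else ((fun=> false), 0%N).
have sS n : [/\ ((s n).2 < (s n.+1).2)%N,
    forall i, (i < (s n).2)%N -> (s n.+1).1 i = (s n).1 i &
    forall c'', (forall i, (i < (s n.+1).2)%N -> c'' i = (s n.+1).1 i) -> n%:R < Q c''].
  exact: (FP (n, s n)).
have sm n m : ((s n).2 <= (s (n + m)).2)%N /\
    (forall i, (i < (s n).2)%N -> (s (n + m)%N).1 i = (s n).1 i).
  elim: m => [|m [IH1 IH2]]; first by rewrite addn0.
  rewrite addnS; have [h1 h2 _] := sS (n + m)%N; split; first exact: leq_trans IH1 (ltnW h1).
  by move=> i iN; rewrite h2 ?IH2// (leq_trans iN).
have sn n : (n <= (s n).2)%N by elim: n => // n IH; have [h _ _] := sS n; exact: leq_ltn_trans IH h.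
(* The point common to all cylinders. Coordinate i is read at stage i + 1, whose cylinder already
   fixes at least i + 1 coordinates. *)
pose c i := (s i.+1).1 i.
have cP n i : (i < (s n).2)%N -> c i = (s n).1 i.
  move=> iN; rewrite /c; have [ni|ni] := leqP n i.+1.
    by rewrite -(subnKC ni); exact: (sm n _).2.
  by rewrite -[in RHS](subnKC (ltnW ni)) (sm i.+1 _).2// (leq_trans _ (sn i.+1)).
have Qc n : n%:R < Q c by have [_ _] := sS n; apply => i; exact: cP.
have h0 : 0 <= Q c by apply: ltW; exact: (Qc 0%N).
by have := lt_trans (archi_boundP h0) (Qc _); rewrite ltxx.
Qed.

Lemma integral_op_ae {dsp : measure_display} {T : measurableType dsp} {R : realType}
    {mu : {measure set T -> \bar R}} {Om : set T} {k : T -> T -> R} (f g : T -> R) :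
  measurable Om ->
  (forall f, L2 mu Om f -> {ae mu, forall x, Om x ->
    mu.-integrable Om (EFin \o (fun y => k x y * f y))}) ->
  L2 mu Om f -> L2 mu Om g -> f = g %[ae mu] ->
  integral_op mu Om k f = integral_op mu Om k g %[ae mu].
Proof.
move=> mOm int_k Lf Lg fg; apply: filterS2 (int_k _ Lf) (int_k _ Lg) => x ixf ixg _.
rewrite /integral_op !patchE; case: ifPn => [/set_mem Ox|//].
rewrite /Rintegral; congr fine; apply: ae_eq_integral => //.
- by have /integrableP[] := ixf Ox.
- by have /integrableP[] := ixg Ox.
- by apply: filterS fg => y /(_ I) -> _.
Qed.

Section Mercer.
Context {dsp : measure_display} {T : measurableType dsp} {R : realType}.
Context {mu : {measure set T -> \bar R}} {Om : set T} {k : T -> T -> R}.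
Context {H : set (T -> R)} {ipH : (T -> R) -> (T -> R) -> R}.
Context {phi : nat -> T -> R} {lam : nat -> R}.
Hypothesis mOm : measurable Om.
Hypothesis mer : mercer mu Om k H ipH phi lam.
Local Notation L2 := (L2 mu Om).
Local Notation ip := (L2ip mu Om).
Local Notation S := (integral_op mu Om k).
Let siL : semi_inner L2 ip := semi_inner_L2 mOm.

Lemma eigenvalues_bounded : exists2 L, 0 < L & forall j, lam j <= L.
Proof.
apply: contrapT => unb.
have /choice[j jP] n : exists j, 4 ^+ n < lam j.
  apply: contrapT => /forallNP h; apply: unb; exists (4 ^+ n); first exact: exprn_gt0.
  by move=> j; rewrite leNgt; apply/negP; exact: h.
have Lphi := mercer_phi_L2 mer.
pose w n := 2^-1 ^+ n *: phi (j n).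
have Lw n : L2 (w n) by exact: (siZ siL).
have w4 n : ip (w n) (w n) <= 4^-1 ^+ n.
  rewrite (si_ipZl siL)// (si_C siL)// (si_ipZl siL)// (mercer_phi_orthonormal mer) eqxx mulr1.
  by rewrite -exprMn -invfM -natrM.
have [h [Lh h0 hw]] := L2_dominant mOm Lw w4.
pose u (c : nat -> bool) n := \sum_(i < n) (c i)%:R *: w i.
have uE c n x : u c n x = \sum_(i < n) (c i)%:R * w i x by rewrite /u fct_sumE.
have Lu c n : L2 (u c n) by apply: (si_sum siL) => i; exact: (siZ siL).
have uh x c n : (forall n, \sum_(i < n) `|w i x| <= h x) -> `|u c n x| <= h x.
  move=> hx; apply: le_trans (hx n); rewrite uE; apply: le_trans (ler_norm_sum _ _ _) _.
  apply: ler_sum => i _; rewrite normrM; case: (c i); first by rewrite normr1 mul1r.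
  by rewrite normr0 mul0r.
(* The increments are bounded by those of \sum_i |w_i x|, uniformly in the choice c. *)
have uB x c m n : (m <= n)%N ->
    `|u c n x - u c m x| <= \sum_(i < n) `|w i x| - \sum_(i < m) `|w i x|.
  move=> mn; rewrite !uE -!(big_mkord xpredT (fun i => (c i)%:R * w i x)).
  rewrite -!(big_mkord xpredT (fun i => `|w i x|)).
  rewrite (big_cat_nat (leq0n m) mn)/= addrAC subrr add0r.
  rewrite [in leRHS](big_cat_nat (leq0n m) mn)/= addrAC subrr add0r.
  apply: le_trans (ler_norm_sum _ _ _) _.
  apply: ler_sum => i _; rewrite normrM; case: (c i); first by rewrite normr1 mul1r.
  by rewrite normr0 mul0r.
have cvA x : (forall n, \sum_(i < n) `|w i x| <= h x) ->
    exists2 l, (\sum_(i < n) `|w i x|) @[n --> \oo] --> l & forall n, \sum_(i < n) `|w i x| <= l.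
  move=> hx.
  have nd : nondecreasing_seq (fun n => \sum_(i < n) `|w i x|).
    by apply/nondecreasing_seqP => n; rewrite big_ord_recr/= lerDl.
  have cv : cvgn (fun n => \sum_(i < n) `|w i x|).
    by apply: nondecreasing_is_cvgn => //; exists (h x) => _ [n _ <-].
  by exists (limn (fun n => \sum_(i < n) `|w i x|)) => //; exact: nondecreasing_cvgn_le.
have /choice[G GP] c : exists g, L2 g /\
    {ae mu, forall x, (forall n, `|u c n x| <= h x) /\ u c n x @[n --> \oo] --> g x}.
  apply: (L2_dominated_limit (Lu c) Lh); first by apply: filterS hw => x hx n; exact: uh.
  apply: filterS hw => x hx.
  rewrite (_ : u c ^~ x = series (fun i => (c i)%:R * w i x)); last first.
    by apply/funext => n; rewrite uE /series/= big_mkord.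
  apply: normed_cvg; apply: nondecreasing_is_cvgn.
    by apply: nondecreasing_series => i _ _ /=.
  exists (h x) => _ [n _ <-]; apply: le_trans (hx n).
  rewrite -[leLHS]/(series (fun i => `|(c i)%:R * w i x|) n) seriesEord/=.
  apply: ler_sum => i _; rewrite normrM; case: (c i); first by rewrite normr1 mul1r.
  by rewrite normr0 mul0r.
have LG c : L2 (G c) by have [] := GP c.
have LSG c : L2 (S (G c)) by exact: (mercer_L2 mer).
apply: (@cantor_baire R (fun c => ip (S (G c)) (S (G c)))).
- move=> r c c_ cc_ Qr.
  have cvG : {ae mu, forall x, G (c_ n) x @[n --> \oo] --> G c x}.
    have GPn := ae_foralln (fun n => (GP (c_ n)).2).
    apply: filterS3 hw (GP c).2 GPn => x hx [_ ucG] GPn.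
    have [l Al lP] := cvA x hx.
    (* The tail bound is the same for all choices. Choices that agree below n have the same partial
       sum [u _ n x], so their limits differ by at most two tails. *)
    have Gu c' n : u c' m x @[m --> \oo] --> G c' x ->
        `|G c' x - u c' n x| <= l - \sum_(i < n) `|w i x|.
      move=> ucx.
      have cg : `|u c' m x - u c' n x| @[m --> \oo] --> `|G c' x - u c' n x|.
        by apply: cvg_norm; apply: cvgB => //; exact: cvg_cst.
      have /cvg_lim <- := cg; last exact: Rhausdorff.
      apply: limr_le; first by apply/cvg_ex; eexists; exact: cg.
      exists n => // m /= nm; apply: le_trans (uB x c' n m nm) _.
      by rewrite lerD2r.
    apply/cvgrPdist_le => e e0.
    have e2 : 0 < e / 2 by rewrite divr_gt0.
    have /cvgrPdist_le/(_ _ e2)[N _ NP] := Al.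
    exists N => // n /= Nn.
    have cu : u (c_ n) n x = u c n x.
      by rewrite !uE; apply: eq_bigr => i _; rewrite cc_.
    have {}NP : l - \sum_(i < n) `|w i x| <= e / 2 by apply: le_trans (NP n Nn); exact: ler_norm.
    have h1 := le_trans (Gu c n ucG) NP.
    have h2 := le_trans (Gu (c_ n) n (GPn n).2) NP.
    rewrite (_ : G c x - G (c_ n) x = (G c x - u c n x) - (G (c_ n) x - u (c_ n) n x)).
      by apply: le_trans (ler_normB _ _) _; rewrite [leRHS]splitr lerD.
    by rewrite cu; ring.
  have Gh c' : {ae mu, forall x, `|G c' x| <= h x}.
    apply: filterS (GP c').2 => x [ux ug].
    have cg : `|u c' m x| @[m --> \oo] --> `|G c' x| by exact: cvg_norm.
    have /cvg_lim <- := cg; last exact: Rhausdorff.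
    by apply: limr_le; [apply/cvg_ex; eexists; exact: cg|exact: nearW].
  have := integral_op_dominated mOm (mercer_integrable mer) (fun n => LG (c_ n)) (LG c) Lh
    (ae_foralln (fun n => Gh (c_ n))) cvG.
  move=> cvS; apply: (L2_fatou mOm (fun n => LSG (c_ n)) _ _ _ _).2.
  + exact: L2_mf.
  + exact: L2_restrict.
  + by apply: filterS cvS.
  + exact: nearW.
- move=> r c N.
  (* Flipping coordinate n >= N stays in the cylinder and moves T g_c by a vector whose square t^2
     exceeds 4^n >= n >= 4 |r|. Since t^2 is at most twice the sum of the two values of Q, one of
     them exceeds r. *)
  pose n := maxn N (Num.bound (4 * `|r|)).
  pose c' i := if i == n then ~~ c i else c i.
  pose s : R := (c' n)%:R - (c n)%:R.
  have s2 : s ^+ 2 = 1.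
    by rewrite /s /c' eqxx; case: (c n); rewrite /= ?sub0r ?subr0 ?sqrrN expr1n.
  have GG : G c' = s *: w n + G c %[ae mu].
    apply: filterS2 (GP c).2 (GP c').2 => x [_ ucx] [_ uc'x] _.
    apply: (cvg_unique _ uc'x) => //=.
    have : s * w n x + u c m x @[m --> \oo] --> s * w n x + G c x.
      by apply: cvgD => //; exact: cvg_cst.
    apply: cvg_trans; apply: near_eq_cvg; exists n.+1 => // m /= nm.
    have D (d : nat -> bool) : u d m x = (d n)%:R * w n x +
        \sum_(i < m | i != Ordinal nm) (d i)%:R * w i x by rewrite uE (bigD1 (Ordinal nm)).
    rewrite !D addrA -mulrDl subrK; congr (_ + _).
    apply: eq_bigr => i; rewrite -val_eqE/= => ni.
    by rewrite /c' (negbTE ni).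
  have SG : S (G c') = (s * (2^-1 ^+ n * lam (j n))) *: phi (j n) + S (G c) %[ae mu].
    have e1 := integral_op_ae mOm (mercer_integrable mer) (LG c')
      (si_lin siL s (Lw n) (LG c)) GG.
    have e2 := integral_op_lin mOm (mercer_integrable mer) s (Lw n) (LG c).
    have e3 := integral_opZ mOm (mercer_integrable mer) (2^-1 ^+ n) (Lphi (j n)).
    have e4 := mercer_eigen mer (j n).
    apply: filterS2 e1 (filterI e2 (filterI e3 e4)) => x /(_ I) -> [/(_ I) ->] [/(_ I) h3 /(_ I) h4] _.
    rewrite -[LHS]/(s * S (w n) x + S (G c) x) h3.
    rewrite -[LHS]/(s * (2^-1 ^+ n * S (phi (j n)) x) + S (G c) x) h4.
    by rewrite -[LHS]/(s * (2^-1 ^+ n * (lam (j n) * phi (j n) x)) + S (G c) x) !mulrA.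
  set t := s * _ in SG.
  have t2 : 4 * r < t ^+ 2.
    have lam0 := mercer_lam_gt0 mer (j n).
    have h1 : 2 ^+ n < 2^-1 ^+ n * lam (j n).
      rewrite -(ltr_pM2l (exprn_gt0 n (ltr0n R 2))) mulrA -!exprMn -natrM.
      by rewrite mulfV// expr1n mul1r.
    have h2 : (2 ^+ n) ^+ 2 < (2^-1 ^+ n * lam (j n)) ^+ 2.
      by rewrite ltr_sqr// nnegrE ?exprn_ge0// mulr_ge0 ?exprn_ge0 ?invr_ge0// ltW.
    rewrite /t exprMn s2 mul1r; apply: le_lt_trans h2.
    apply: (@le_trans _ _ n%:R).
      apply: (@le_trans _ _ (4 * `|r|)); first by rewrite ler_wpM2l// ler_norm.
      have h4 : 0 <= 4 * `|r| by rewrite mulr_ge0.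
      by apply: ltW; apply: lt_le_trans (archi_boundP h4) _; rewrite ler_nat leq_maxr.
    rewrite -exprM muln2 -natrX ler_nat; apply: (@leq_trans (2 ^ n)); first exact/ltnW/ltn_expl.
    by rewrite leq_exp2l// -addnn leq_addr.
  have tab : t ^+ 2 <= 2 * (ip (S (G c')) (S (G c')) + ip (S (G c)) (S (G c))).
    apply: le_trans (si_ipB_le siL (LSG c') (LSG c)).
    have Lt : L2 (t *: phi (j n)) by exact: (siZ siL).
    have LB := siB siL (LSG c') (LSG c).
    have ae : S (G c') - S (G c) = t *: phi (j n) %[ae mu].
      apply: filterS SG => x /(_ I) h1 _.
      by rewrite -[LHS]/(S (G c') x - S (G c) x) h1 -[X in X - _]/((t *: phi (j n)) x + S (G c) x) addrK.
    rewrite (L2ip_ae mOm LB Lt LB ae) (si_C siL)// (L2ip_ae mOm LB Lt Lt ae).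
    rewrite (si_ipZl siL)// (si_C siL)// (si_ipZl siL)// (mercer_phi_orthonormal mer) eqxx.
    by rewrite mulr1 -expr2.
  have [ra|ra] := ltP r (ip (S (G c')) (S (G c'))).
    exists c' => // i iN; rewrite /c'; case: eqP => // ein.
    by move: iN; rewrite ein ltnNge leq_maxl.
  by exists c => //; lra.
Qed.
End Mercer.

(** * Coefficient descriptions of the spaces *)

Section Coefficients.
Context {dsp : measure_display} {T : measurableType dsp} {R : realType}.
Context {mu : {measure set T -> \bar R}} {Om : set T} {k : T -> T -> R}.
Context {H : set (T -> R)} {ipH : (T -> R) -> (T -> R) -> R}.
Context {phi : nat -> T -> R} {lam : nat -> R}.
Hypothesis mOm : measurable Om.
Hypothesis mer : mercer mu Om k H ipH phi lam.
Hypothesis rkhs : is_RKHS Om k H ipH.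
Local Notation L2 := (L2 mu Om).
Local Notation ip := (L2ip mu Om).
Local Notation S := (integral_op mu Om k).
Local Notation e := (fun j => Num.sqrt (lam j) *: phi j).
Let siL : semi_inner L2 ip := semi_inner_L2 mOm.
Let Lphi := mercer_phi_L2 mer.
Let ophi := mercer_phi_orthonormal mer.
Let lam0 := mercer_lam_gt0 mer.

Lemma semi_inner_RKHS : semi_inner H ipH.
Proof.
split; [exact: rkhs0 rkhs|exact: rkhs_lin rkhs|exact: rkhs_ipC rkhs
  |exact: rkhs_ip_lin rkhs|exact: rkhs_ip_ge0 rkhs].
Qed.
Let siH := semi_inner_RKHS.

(** A Riesz-Fischer theorem for a limit that is already known pointwise. Fatou's lemma applied to f
    - S_m bounds its square by the tail of \sum_j b_j^2, so the partial sums S_m also converge to f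
    in norm, and coefficients pass to the limit. *)
Lemma L2_limit_coef (b : nat -> R) (M : R) (n_ : nat -> nat) (f : T -> R) :
  (forall n, \sum_(j < n) b j ^+ 2 <= M) -> (forall i, (i <= n_ i)%N) ->
  measurable_fun setT f -> f = f \_ Om ->
  {ae mu, forall x, Om x -> psum phi b (n_ i) x @[i --> \oo] --> f x} ->
  L2 f /\ forall j, ip f (phi j) = b j.
Proof.
move=> bM n_ge mf fO cvf.
pose B n := \sum_(j < n) b j ^+ 2.
have ndB : nondecreasing_seq B.
  by apply/nondecreasing_seqP => n; rewrite /B big_ord_recr/= lerDl sqr_ge0.
have cvB : cvgn B by apply: nondecreasing_is_cvgn => //; exists M => _ [n _ <-]; exact: bM.
set l := limn B in cvB.
have Bl n : B n <= l by exact: nondecreasing_cvgn_le.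
have Lp n : L2 (psum phi b n) by exact: (si_psum siL Lphi).
have hm m : L2 (f - psum phi b m) /\ ip (f - psum phi b m) (f - psum phi b m) <= l - B m.
  apply: (L2_fatou mOm (u := fun i => psum phi b (n_ i) - psum phi b m)).
  - by move=> i; exact: (siB siL).
  - by apply: measurable_funB => //; exact: L2_mf.
  - apply/funext => x; rewrite patchE; case: ifPn => //; rewrite notin_setE => Ox.
    rewrite -[LHS]/(f x - psum phi b m x) (L2_out fO Ox).
    by rewrite (L2_out (L2_restrict (Lp m)) Ox) subr0.
  - by apply: filterS cvf => x h /h fx; apply: cvgB => //; exact: cvg_cst.
  - exists m => // i /= mi; rewrite (si_sqr_psumB siL)// ?lerB// ?(leq_trans mi)//.
    exact: Bl.
have Lf : L2 f by rewrite -[f](subrK (psum phi b 0)); apply: (siD siL) => //; exact: (hm 0%N).1.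
split => // j; apply/eqP; rewrite -subr_eq0 -sqrf_eq0 eq_le sqr_ge0 andbT.
have h m : (j < m)%N -> (ip f (phi j) - b j) ^+ 2 <= l - B m.
  move=> jm; have [Lm lm] := hm m; apply: le_trans lm.
  have := si_cauchy_schwarz siL Lm (Lphi j).
  by rewrite ophi eqxx mulr1 (si_ipBl siL)// (si_ip_psum siL)// jm.
have c0 : l - B m @[m --> \oo] --> 0.
  by rewrite -[X in _ --> X](subrr l); apply: cvgB => //; exact: cvg_cst.
have /cvg_lim <- := c0; last exact: Rhausdorff.
apply: limr_ge; first by apply/cvg_ex; eexists; exact: c0.
by exists j.+1 => // m /= jm; exact: h.
Qed.

Lemma L2_parseval f : L2 f -> (\sum_(j <oo) (ip f (phi j) ^+ 2)%:E = (ip f f)%:E)%E.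
Proof.
move=> Lf; apply: (parseval siL Lphi ophi Lf).
have := mercer_expansion mer Lf; apply: cvg_trans; apply: near_eq_cvg; apply: nearW => n.
exact: (L2normE mOm (siB siL Lf (si_psum siL Lphi (fun j => ip f (phi j)) n))).
Qed.

Lemma L2_eq_coef f g : L2 f -> L2 g -> (forall j, ip f (phi j) = ip g (phi j)) -> f = g %[ae mu].
Proof.
move=> Lf Lg fg; apply: ae_eq_sub0; apply: (L2ip_ae0 mOm); first exact: (siB siL).
apply: EFin_inj; rewrite -L2_parseval; last exact: (siB siL).
by apply: eseries0 => j _ _; rewrite (si_ipBl siL)// fg subrr expr0n.
Qed.

Lemma integral_op_psum b n :
  S (psum phi b n) = psum phi (fun j => lam j * b j) n %[ae mu].
Proof.
elim: n => [|n IH].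
  have := integral_opZ mOm (mercer_integrable mer) 0 (Lphi 0%N).
  by rewrite !scale0r /psum !big_ord0.
have E c : psum phi c n.+1 = c n *: phi n + psum phi c n.
  by rewrite /psum big_ord_recr/= addrC.
have Lp : L2 (psum phi b n) by exact: (si_psum siL Lphi _ _).
rewrite !E; apply: filterS3 (integral_op_lin mOm (mercer_integrable mer) (b n) (Lphi n) Lp)
  (mercer_eigen mer n) IH => x /(_ I) -> /(_ I) h1 /(_ I) h2 _.
rewrite -[LHS]/(b n * S (phi n) x + S (psum phi b n) x) h1 h2.
rewrite -[RHS]/(lam n * b n * phi n x + psum phi (fun j => lam j * b j) n x).
by rewrite -[X in b n * X]/(lam n * phi n x); congr (_ + _); ring.
Qed.

Lemma L2_norm f : L2 f -> L2 (fun x => `|f x|).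
Proof.
move=> Lf; apply/L2P; split.
- by apply: measurableT_comp => //; exact: (L2_mf Lf).
- by under eq_integral do rewrite real_normK ?num_real//; exact: (L2_lty Lf).
- apply/funext => x; rewrite patchE; case: ifPn => //; rewrite notin_setE => Ox.
  by rewrite (L2_out (L2_restrict Lf) Ox) normr0.
Qed.

(** On finite sums T is diagonal by linearity. A rapidly convergent subsequence of the partial sums
    of f is dominated by |f| + h, so its images converge to T f almost everywhere; the bound on the
    eigenvalues keeps their coefficients square summable, and [L2_limit_coef] identifies the
    limit. *)
Lemma integral_op_coef f : L2 f -> forall j, ip (S f) (phi j) = lam j * ip f (phi j).
Proof.
move=> Lf.
pose c j := ip f (phi j).
have Lp n : L2 (psum phi c n) by exact: (si_psum siL Lphi _ _).
(* The squared errors 4^-i are summable enough for [L2_dominant], and i <= n_i is what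
   [L2_limit_coef] requires of a subsequence. *)
have /choice[n_ n_P] i : exists n, (i <= n)%N /\
    ip (f - psum phi c n) (f - psum phi c n) <= 4^-1 ^+ i.
  have := mercer_expansion mer Lf => /cvgrPdist_lt/(_ (2^-1 ^+ i) _)[].
    by rewrite exprn_gt0// invr_gt0.
  move=> N _ NP; exists (maxn i N); split; first exact: leq_maxl.
  have Lfp : L2 (f - psum phi c (maxn i N)) by exact: (siB siL).
  have := NP (maxn i N) (leq_maxr _ _); rewrite /= sub0r normrN => {}NP.
  have {}NP := le_lt_trans (ler_norm _) NP.
  move: NP; rewrite -[X in L2norm mu (f - X)]/(psum phi c (maxn i N)) (L2normE mOm)// /ip_norm.
  move=> /ltW; rewrite -ler_sqr ?nnegrE ?sqrtr_ge0 ?exprn_ge0 ?invr_ge0//.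
  rewrite sqr_sqrtr ?(si_ge0 siL)// => /le_trans; apply.
  rewrite -exprM mulnC exprM; apply: lerXn2r; rewrite ?nnegrE ?exprn_ge0 ?invr_ge0//.
  by rewrite exprVn -natrX.
pose w i := f - psum phi c (n_ i).
have Lw i : L2 (w i) by exact: (siB siL).
have [h [Lh h0 hw]] := L2_dominant mOm Lw (fun i => (n_P i).2).
have Lh' : L2 ((fun x => `|f x|) + h) by apply: (siD siL) => //; exact: L2_norm.
have dom : {ae mu, forall x, forall i, `|psum phi c (n_ i) x| <= ((fun x => `|f x|) + h) x}.
  apply: filterS hw => x hx i.
  have -> : psum phi c (n_ i) x = f x - w i x.
    by rewrite -[w i x]/(f x - psum phi c (n_ i) x) opprB addrC subrK.
  apply: le_trans (ler_normB _ _) _; rewrite -[leRHS]/(`|f x| + h x) lerD2l.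
  by apply: le_trans (hx i.+1); rewrite big_ord_recr/= lerDr sumr_ge0.
have cvf : {ae mu, forall x, psum phi c (n_ i) x @[i --> \oo] --> f x}.
  apply: filterS hw => x hx.
  have cv : cvgn (series (fun i => `|w i x|)).
    apply: nondecreasing_is_cvgn; first exact: nondecreasing_series.
    by exists (h x) => _ [n _ <-]; rewrite seriesEord/=; exact: hx.
  have /norm_cvg0P w0 := cvg_series_cvg_0 cv.
  rewrite (_ : (fun i => psum phi c (n_ i) x) = (fun i => f x - w i x)).
    by rewrite -[X in _ --> X]subr0; apply: cvgB => //; exact: cvg_cst.
  apply/funext => i.
  by rewrite -[w i x]/(f x - psum phi c (n_ i) x) opprB addrC subrK.
have cvS := integral_op_dominated mOm (mercer_integrable mer) (fun i => Lp (n_ i)) Lf Lh' dom cvf.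
have [L L0 lamL] := eigenvalues_bounded mOm mer.
have LS := mercer_L2 mer Lf.
apply: (L2_limit_coef (M := L ^+ 2 * ip f f) (n_ := n_) _ (fun i => (n_P i).1) _ _ _).2.
- move=> n; apply: (@le_trans _ _ (L ^+ 2 * \sum_(j < n) c j ^+ 2)).
    rewrite mulr_sumr; apply: ler_sum => j _; rewrite exprMn ler_wpM2r ?sqr_ge0//.
    by rewrite ler_sqr ?nnegrE// ltW.
  by rewrite ler_wpM2l ?sqr_ge0// (si_bessel siL).
- exact: (L2_mf LS).
- exact: (L2_restrict LS).
- apply: filterS2 cvS (ae_foralln (fun i => integral_op_psum c (n_ i))) => x cx px _.
  by under eq_fun do rewrite -(px _ I).
Qed.

Let eH : forall j, H (e j). Proof. by have [] := mercer_basis mer. Qed.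
Let eo : forall i j, ipH (e i) (e j) = (i == j)%:R. Proof. by have [] := mercer_basis mer. Qed.

Lemma rkhs_pointwise (u : nat -> T -> R) f : (forall n, H (u n)) -> H f ->
  ip_norm ipH (f - u n) @[n --> \oo] --> (0 : R) ->
  forall x, u n x @[n --> \oo] --> f x.
Proof.
move=> Hu Hf cv x; have [Ox|Ox] := pselect (Om x); last first.
  rewrite (rkhs_dom rkhs Hf) patchE memNset//.
  by under eq_fun do rewrite (rkhs_dom rkhs (Hu _)) patchE memNset//; exact: cvg_cst.
have Hk := rkhs_kernel rkhs Ox.
have bnd n : `|f x - u n x| <= Num.sqrt (ipH (k x \_ Om) (k x \_ Om)) * ip_norm ipH (f - u n).
  have Hfu := siB siH Hf (Hu n).
  rewrite -[f x - _]/((f - u n) x) -(rkhs_reproducing rkhs Hfu Ox).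
  rewrite -ler_sqr ?nnegrE ?mulr_ge0 ?sqrtr_ge0// real_normK ?num_real//.
  rewrite exprMn !sqr_sqrtr ?(si_ge0 siH)// mulrC.
  exact: (si_cauchy_schwarz siH).
have c0 : Num.sqrt (ipH (k x \_ Om) (k x \_ Om)) * ip_norm ipH (f - u n) @[n --> \oo] --> 0.
  by rewrite -[X in _ --> X](mulr0 (Num.sqrt (ipH (k x \_ Om) (k x \_ Om)))); apply: cvgM => //; exact: cvg_cst.
apply/cvgrPdist_le => d d0; have /cvgrPdist_le/(_ d d0)[N _ NP] := c0.
exists N => // n /NP; rewrite /= sub0r normrN => h.
exact: le_trans (bnd n) (le_trans (ler_norm _) h).
Qed.

(** The expansion in H converges pointwise by the reproducing property. Read in the phi_j, its
    coefficients are square summable because lam is bounded, so the pointwise limit is also the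
    limit in L_2. *)
Lemma rkhs_L2 f : H f -> L2 f /\ forall j, ip f (phi j) = Num.sqrt (lam j) * ipH f (e j).
Proof.
move=> Hf; have [L L0 lamL] := eigenvalues_bounded mOm mer.
pose b j := Num.sqrt (lam j) * ipH f (e j).
have pE n : psum e (fun j => ipH f (e j)) n = psum phi b n.
  by apply: eq_bigr => j _; rewrite scalerA mulrC.
have [_ _ /(_ f Hf) cvf] := mercer_basis mer.
have Hp n : H (psum e (fun j => ipH f (e j)) n) by exact: (si_psum siH eH _ _).
have pf := rkhs_pointwise Hp Hf cvf.
have Lp n : L2 (psum phi b n) by exact: (si_psum siL Lphi _ _).
apply: (L2_limit_coef (M := L * ipH f f) (n_ := id)) => //.
- move=> n; apply: (@le_trans _ _ (L * \sum_(j < n) ipH f (e j) ^+ 2)).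
    rewrite mulr_sumr; apply: ler_sum => j _.
    by rewrite exprMn sqr_sqrtr ?(ltW (lam0 _))// ler_wpM2r ?sqr_ge0.
  apply: ler_wpM2l; first exact: ltW.
  exact: (si_bessel siH eH eo n Hf).
- apply: (measurable_fun_cvg (h := fun n => psum e (fun j => ipH f (e j)) n)) => [n|x _].
    by rewrite pE; exact: L2_mf.
  exact: pf.
- exact: (rkhs_dom rkhs).
- by apply: nearW => x _; under eq_fun do rewrite -pE; exact: pf.
Qed.

Local Notation psq := (power_sqnorm mu Om phi lam).

Lemma rkhs_power f : L2 f ->
  (rkhs_space mu Om H f <-> (psq 1 f < +oo)%E) /\
  (rkhs_space mu Om H f -> 0 <= rkhs_norm mu H ipH f /\
    ((rkhs_norm mu H ipH f ^+ 2)%:E = psq 1 f)%E).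
Proof.
move=> Lf.
have psqE g : H g -> f = g %[ae mu] -> psq 1 f = (ipH g g)%:E.
  move=> Hg fg; have [Lg gc] := rkhs_L2 Hg.
  have [_ _ /(_ g Hg) cvg] := mercer_basis mer.
  rewrite -(parseval siH eH eo Hg cvg); apply: eq_eseriesr => j _; congr EFin.
  rewrite (L2ip_ae mOm Lf Lg (Lphi j) fg) gc powR_inv1 ?ltW// real_normK ?num_real//.
  by rewrite exprMn sqr_sqrtr ?ltW// mulKf ?gt_eqF.
split; last first.
  move=> [_ [g Hg fg]].
  (* By [psqE] all representatives have the same norm, so the infimum is taken over a singleton. *)
  have E : [set ip_norm ipH g | g in [set g | H g /\ f = id g %[ae mu]]] = [set ip_norm ipH g].
    apply/seteqP; split => [_ [g' [Hg' fg'] <-]|_ ->]; last by exists g.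
    rewrite /= /ip_norm; congr Num.sqrt; apply: EFin_inj.
    by rewrite -(psqE g)// -(psqE g').
  rewrite /rkhs_norm /image_norm E inf1; split; first exact: sqrtr_ge0.
  by rewrite sqr_sqrtr ?(si_ge0 siH)// -(psqE g).
split=> [[_ [g Hg fg]]|fin]; first by rewrite (psqE g)// ltry.
split => //.
(* The coefficients that a representative in H must have. Their partial sums are Cauchy in H;
   completeness yields g, and g agrees with f because both have the same coefficients in L_2. *)
pose b j := ip f (phi j) / Num.sqrt (lam j).
have lam0' j : 0 < Num.sqrt (lam j) by rewrite sqrtr_gt0.
have psqb : (psq 1 f = \sum_(j <oo) (b j ^+ 2)%:E)%E.
  apply: eq_eseriesr => j _; congr EFin.
  rewrite powR_inv1 ?ltW// real_normK ?num_real// /b exprMn exprVn sqr_sqrtr ?ltW//.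
  by rewrite mulrC.
have [l _ cl] := cvg_nneseries_fin (fun j => sqr_ge0 (b j)) (ltac:(by rewrite -psqb)).
have Hp n : H (psum e b n) by exact: (si_psum siH eH).
have norm_sym m n : ip_norm ipH (psum e b m - psum e b n) = ip_norm ipH (psum e b n - psum e b m).
  rewrite /ip_norm !(si_ipB siH)// (si_C siH (Hp m) (Hp n)); congr Num.sqrt; ring.
have cauchy d : 0 < d -> exists N : nat, forall m n : nat, (N <= m)%N -> (N <= n)%N ->
    ip_norm ipH (psum e b m - psum e b n) < d.
  move=> d0; have d2 : 0 < d ^+ 2 / 2 by rewrite divr_gt0// exprn_gt0.
  have /cvgrPdist_lt/(_ _ d2)[N _ NP] := cl.
  exists N; suff h m n : (N <= m)%N -> (m <= n)%N -> ip_norm ipH (psum e b n - psum e b m) < d.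
    move=> m n Nm Nn; have [mn|/ltnW nm] := leqP m n; last exact: h.
    by rewrite norm_sym; exact: h.
  move=> Nm mn; rewrite -ltr_sqr ?nnegrE ?sqrtr_ge0 ?ltW// sqr_sqrtr; last first.
    by apply: (si_ge0 siH); exact: (siB siH).
  rewrite (si_sqr_psumB siH eH eo)//.
  have /ltr_normlP[h1 h2] := NP m Nm; have /ltr_normlP[h3 h4] := NP n (leq_trans Nm mn).
  lra.
have [g Hg gcv] := rkhs_complete rkhs Hp cauchy.
exists g => //.
have [Lg gc] := rkhs_L2 Hg.
apply: L2_eq_coef => // j; rewrite gc.
suff -> : ipH g (e j) = b j by rewrite /b mulrC divfK// gt_eqF.
(* For n > j the n-th partial sum has j-th coefficient b_j, so Cauchy-Schwarz bounds the difference
   by its distance to g, which tends to 0. *)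
apply/eqP; rewrite -subr_eq0 -normr_eq0 eq_le normr_ge0 andbT.
have /cvg_lim <- := gcv; last exact: Rhausdorff.
apply: limr_ge; first by apply/cvg_ex; eexists; exact: gcv.
exists j.+1 => // n /= jn.
rewrite -ler_sqr ?nnegrE ?sqrtr_ge0// sqr_sqrtr; last first.
  by apply: (si_ge0 siH); exact: (siB siH).
have Hgu := siB siH (Hp n) Hg.
have := si_cauchy_schwarz siH Hgu (eH j).
rewrite eo eqxx mulr1 (si_ipBl siH)// (si_ip_psum siH eH eo) jn real_normK ?num_real//.
by apply: le_trans; rewrite -sqrrN opprB.
Qed.

Lemma range_power f : range_space mu Om k f ->
  0 <= range_norm mu Om k f /\ ((range_norm mu Om k f ^+ 2)%:E = psq 2 f)%E.
Proof.
move=> [Lf [g Lg fg]].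
have psqE g' : L2 g' -> f = S g' %[ae mu] -> psq 2 f = (ip g' g')%:E.
  move=> {}Lg {}fg; rewrite -L2_parseval//; apply: eq_eseriesr => j _; congr EFin.
  rewrite (L2ip_ae mOm Lf (mercer_L2 mer Lg) (Lphi j) fg) integral_op_coef//.
  rewrite powR_invn ?ltW// real_normK ?num_real// exprMn mulKf//.
  by rewrite expf_neq0// gt_eqF.
have E : [set L2norm mu g | g in [set g | L2 g /\ f = S g %[ae mu]]] = [set ip_norm ip g].
  apply/seteqP; split => [_ [g' [Lg' fg'] <-]|_ ->]; last by exists g => //; exact: (L2normE mOm Lg).
  rewrite /= (L2normE mOm Lg') /ip_norm; congr Num.sqrt; apply: EFin_inj.
  by rewrite -(psqE g)// -(psqE g').
rewrite /range_norm /image_norm E inf1; split; first exact: sqrtr_ge0.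
by rewrite sqr_sqrtr ?(si_ge0 siL)// -(psqE g).
Qed.

(** On finite sums T is inverted by dividing the coefficients by lam. These sums are the competitors
    used to bound the K-functional from above. *)
Lemma range_psum b n : range_space mu Om k (psum phi b n).
Proof.
split; first exact: (si_psum siL Lphi).
exists (psum phi (fun j => (lam j)^-1 * b j) n); first exact: (si_psum siL Lphi).
have := integral_op_psum (fun j => (lam j)^-1 * b j) n.
rewrite (_ : psum phi (fun j => lam j * ((lam j)^-1 * b j)) n = psum phi b n).
  by apply: filterS => x + _ => /(_ I) ->.
by apply: eq_bigr => i _; rewrite mulVKf// gt_eqF.
Qed.

Lemma rkhs_psum b n : rkhs_space mu Om H (psum phi b n).
Proof.
split; first exact: (si_psum siL Lphi).
exists (psum phi b n); last by apply: nearW.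
rewrite (_ : psum phi b n = psum e (fun j => b j / Num.sqrt (lam j)) n); first exact: (si_psum siH eH).
by apply: eq_bigr => i _; rewrite scalerA divfK// gt_eqF// sqrtr_gt0.
Qed.

Lemma L2_power f : L2 f ->
  0 <= L2norm mu f /\ ((L2norm mu f ^+ 2)%:E = psq 0 f)%E.
Proof.
move=> Lf; rewrite (L2normE mOm Lf); split; first exact: sqrtr_ge0.
rewrite sqr_sqrtr ?(si_ge0 siL)// -L2_parseval//; apply: eq_eseriesr => j _; congr EFin.
by rewrite oppr0 powRr0 mul1r real_normK ?num_real.
Qed.

(** With lam_j <= L the constant L^(t - s) absorbs the factor lam_j^(t - s); the power spaces are
    nested for this reason. *)
Lemma power_sqnorm_le (s t : R) : s <= t ->
  exists2 C, 0 < C & forall f, (psq s f <= C%:E * psq t f)%E.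
Proof.
move=> st; have [L L0 lamL] := eigenvalues_bounded mOm mer.
exists (L `^ (t - s)); first exact: powR_gt0.
move=> f; rewrite /power_sqnorm -nneseriesZl => [|j _]; last first.
  by rewrite lee_fin mulr_ge0 ?powR_ge0 ?exprn_ge0.
apply: lee_nneseries => [j _ _|j _]; first by rewrite lee_fin mulr_ge0 ?powR_ge0 ?exprn_ge0.
rewrite -EFinM lee_fin [leRHS]mulrA ler_wpM2r ?exprn_ge0//.
have -> : lam j `^ (- s) = lam j `^ (t - s) * lam j `^ (- t).
  rewrite -powRD; first by congr powR; ring.
  by rewrite (gt_eqF (lam0 j)) implybT.
rewrite ler_wpM2r ?powR_ge0// ge0_ler_powR ?subr_ge0// nnegrE ltW//.
Qed.
End Coefficients.

(** * Integrals of powers *)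

(* For the K-functional, whose measurability in t is then not needed. *)
Lemma ge0_le_integral_nonmeasurable {d : measure_display} {T : measurableType d} {R : realType}
    (mu : {measure set T -> \bar R}) (D : set T) (f g : T -> \bar R) :
  (forall x, D x -> (0 <= f x)%E) -> (forall x, D x -> (f x <= g x)%E) ->
  (\int[mu]_(x in D) f x <= \int[mu]_(x in D) g x)%E.
Proof.
move=> f0 fg; rewrite !ge0_integralE//; last by move=> x Dx; exact: le_trans (f0 x Dx) (fg x Dx).
apply: le_ereal_sup => _ [h hf <-]; exists h => // x.
apply: le_trans (hf x) _; rewrite !patchE; case: ifP => // /set_mem; exact: fg.
Qed.

Section PowerIntegrals.
Context {R : realType}.
Notation mu := (@lebesgue_measure R).

Lemma integral_powR (p x y : R) : p + 1 != 0 -> 0 < x -> x < y ->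
  (\int[mu]_(t in `[x, y]) (t `^ p)%:E)%E =
  ((y `^ (p + 1) - x `^ (p + 1)) / (p + 1))%:E.
Proof.
move=> p1 x0 xy.
have der (t : R) : 0 < t -> is_derive t 1 (fun t => t `^ (p + 1) / (p + 1)) (t `^ p).
  move=> t0; have h := is_derive1_powR (p + 1) t0.
  have := is_deriveM (is_derive1_powR (p + 1) t0) (is_derive_cst ((p + 1)^-1) t 1).
  rewrite (_ : _ *: _ + _ = t `^ p)//.
  rewrite scaler0 add0r addrK /GRing.scale/= mulrA mulVf ?mul1r//.
rewrite (@continuous_FTC2 _ _ (fun t => t `^ (p + 1) / (p + 1)))//.
- by rewrite -EFinB mulrBl.
- apply: derivable_within_continuous => t /=; rewrite in_itv/= => /andP[xt _].
  by apply: derivable_powR; rewrite in_itv/= andbT (lt_le_trans x0).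
- have cF (t : R) : 0 < t -> {for t, continuous (fun t => t `^ (p + 1) / (p + 1))}.
    by move=> t0; apply/differentiable_continuous/derivable1_diffP; have [] := der t t0.
  split.
  + move=> t; rewrite in_itv/= => /andP[xt _].
    by have [] := der t (lt_trans x0 xt).
  + exact/cvg_at_right_filter/cF.
  + by apply/cvg_at_left_filter/cF; exact: lt_trans xy.
- move=> t; rewrite in_itv/= => /andP[xt _].
  by rewrite derive1E; have [_ ->] := der t (lt_trans x0 xt).
Qed.

Lemma integral_bigcup_itv_le (f : R -> R) (x_ y_ : nat -> R) (C : \bar R) :
  {homo x_ : m n / (m <= n)%N >-> n <= m} -> {homo y_ : m n / (m <= n)%N >-> m <= n} ->
  measurable_fun setT f -> (forall t, 0 <= f t) ->
  (forall n, (\int[mu]_(t in `[x_ n, y_ n]) (f t)%:E <= C)%E) ->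
  (\int[mu]_(t in \bigcup_n `[x_ n, y_ n]%classic) (f t)%:E <= C)%E.
Proof.
move=> xd yi mf f0 fC.
have := @ge0_nondecreasing_set_cvg_integral _ (measurableTypeR R) R (fun n => `[x_ n, y_ n]%classic)
  (fun t => (f t)%:E) mu.
move=> /(_ _ _ _ _)/cvg_lim <- //.
- apply: lime_le; last exact: nearW.
  apply: ereal_nondecreasing_is_cvgn => m n mn; apply: ge0_subset_integral => //.
  + by apply/measurable_EFinP; exact: measurable_funTS.
  + by move=> t _; rewrite lee_fin.
  + by apply: subset_itv; rewrite bnd_simp; [exact: xd|exact: yi].
- move=> m n mn; rewrite subsetEset.
  by apply: subset_itv; rewrite bnd_simp; [exact: xd|exact: yi].
- by move=> n; apply/measurable_EFinP; exact: measurable_funTS.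
- by move=> n t _; rewrite lee_fin.
Qed.

Lemma integral_powR0_le (p b : R) : 0 < p + 1 -> 0 < b ->
  (\int[mu]_(t in `]0%R, b]) (t `^ p)%:E <= (b `^ (p + 1) / (p + 1))%:E)%E.
Proof.
move=> p1 b0.
(* The index [n.+2] keeps the left end strictly below b already for n = 0, as [integral_powR]
   requires. *)
have -> : `]0%R, b]%classic = \bigcup_n `[b / n.+2%:R, b]%classic.
  apply/seteqP; split => t /=; rewrite in_itv/=.
    move=> /andP[t0 tb]; exists (Num.bound (b / t)) => //=.
    rewrite in_itv/= tb andbT ler_pdivrMr// mulrC -ler_pdivrMr//.
    apply: ltW; apply: lt_le_trans (archi_boundP _) _; first by rewrite divr_ge0 ?ltW.
    by rewrite ler_nat -addn2 leq_addr.
  move=> [n _ /=]; rewrite in_itv/= => /andP[h ->]; rewrite andbT.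
  by apply: lt_le_trans h; rewrite divr_gt0.
apply: integral_bigcup_itv_le => //.
- by move=> m n mn; rewrite ler_pM2l// lef_pV2 ?posrE// ler_nat !ltnS.
- by move=> t; exact: powR_ge0.
- move=> n; rewrite integral_powR ?gt_eqF//; [|exact: divr_gt0|]; last first.
    by rewrite ltr_pdivrMr// ltr_pMr// ltr1n.
  by rewrite lee_fin ler_pM2r ?invr_gt0// gerBl powR_ge0.
Qed.

Lemma integral_powRy_le (p b : R) : p + 1 < 0 -> 0 < b ->
  (\int[mu]_(t in `[b, +oo[) (t `^ p)%:E <= (b `^ (p + 1) / - (p + 1))%:E)%E.
Proof.
move=> p1 b0.
have -> : `[b, +oo[%classic = \bigcup_n `[b, b + n.+1%:R]%classic.
  apply/seteqP; split => t /=; rewrite in_itv/= ?andbT.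
    move=> bt; exists (Num.bound (t - b)) => //=.
    rewrite in_itv/= bt/= -lerBlDl.
    apply: ltW; apply: lt_le_trans (archi_boundP _) _; first by rewrite subr_ge0.
    by rewrite ler_nat.
  by move=> [n _ /=]; rewrite in_itv/= => /andP[].
apply: integral_bigcup_itv_le => //.
- by move=> m n mn; rewrite lerD2l ler_nat ltnS.
- by move=> t; exact: powR_ge0.
- move=> n; rewrite integral_powR ?lt_eqF// ?ltrDl//.
  rewrite lee_fin invrN mulrN mulrBl lerBlDr addrC.
  by rewrite addNr mulr_ge0_le0 ?powR_ge0// invr_le0 ltW.
Qed.

(** The weight t^(-2z) / t of the interpolation norm times the multiplier m_j(t), with a in place of
    lam_j. *)
Definition min_kernel (z a t : R) : R := t `^ (- z *+ 2 - 1) * Num.min 1 (t ^+ 2 / a).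

Lemma min_kernel_ge0 z a t : 0 < a -> 0 <= min_kernel z a t.
Proof.
by move=> a0; rewrite mulr_ge0 ?powR_ge0// le_min ler01 mulr_ge0 ?sqr_ge0// invr_ge0 ltW.
Qed.

Lemma measurable_min_kernel z a : measurable_fun [set: R] (min_kernel z a).
Proof.
apply: measurable_funM; first exact: measurable_powR.
apply: measurable_minr => //; apply: measurable_funM => //.
Qed.

(** Scaling t by b = sqrt a shows that the integral is a constant times a^-z; b is also where the
    minimum changes branch. The lower constant comes from [b, 2b], where the minimum is 1. The upper
    one adds 1 / (2 - 2z) from t^2 / a on ]0, b] and 1 / (2z) from 1 on [b, +oo[; convergence at 0
    uses z < 1, at infinity z > 0. *)
Lemma integral_min_kernel z : 0 < z < 1 -> exists c C : R, [/\ 0 < c, 0 < C & forall a, 0 < a ->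
  ((c * a `^ (- z))%:E <= \int[mu]_(t in `]0%R, +oo[) (min_kernel z a t)%:E <= (C * a `^ (- z))%:E)%E].
Proof.
move=> /andP[z0 z1].
exists ((1 - 2 `^ (- z *+ 2)) / (z *+ 2)), (((1 - z) *+ 2)^-1 + (z *+ 2)^-1).
have z20 : 0 < z *+ 2 by rewrite pmulrn_lgt0.
have z12 : 0 < (1 - z) *+ 2 by rewrite pmulrn_lgt0// subr_gt0.
split.
- rewrite divr_gt0// subr_gt0 mulNrn powRN invf_lt1 ?powR_gt0//.
  by have := @gt0_ltr_powR R (z *+ 2) z20 1 2; rewrite powR1 /= => -> //; rewrite ?nnegrE ?ltr1n.
- by rewrite addr_gt0 ?invr_gt0.
move=> a a0; pose b := Num.sqrt a.
have b0 : 0 < b by rewrite sqrtr_gt0.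
have b2 : b ^+ 2 = a by rewrite sqr_sqrtr// ltW.
have baz : b `^ (- z *+ 2) = a `^ (- z).
  by rewrite -b2 -powR_mulrn ?ltW// -powRrM; congr powR; rewrite mulr_natl.
have p1 : - z *+ 2 - 1 + 1 = - z *+ 2 by rewrite subrK.
have mk (D : set R) : measurable_fun D (EFin \o min_kernel z a).
  by apply/measurable_EFinP; apply: measurable_funTS; exact: measurable_min_kernel.
apply/andP; split.
  apply: (@le_trans _ _ (\int[mu]_(t in `[b, (2 * b)%R]) (t `^ (- z *+ 2 - 1)%R)%:E : \bar R)%E).
    rewrite integral_powR// ?p1 ?mulNrn ?oppr_eq0 ?gt_eqF//; last by rewrite ltr_pMl// ltr1n.
    rewrite lee_fin powRM ?(ltW b0)// -mulNrn baz.
    rewrite le_eqVlt; apply/orP; left; apply/eqP; rewrite mulNrn; field.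
    by rewrite gt_eqF.
  apply: (@le_trans _ _ (\int[mu]_(t in `[b, (2 * b)%R]) (min_kernel z a t)%:E : \bar R)%E).
    apply: ge0_le_integral_nonmeasurable => t; first by move=> _; rewrite lee_fin powR_ge0.
    rewrite /= in_itv/= => /andP[bt _]; rewrite lee_fin /min_kernel min_l ?mulr1//.
    by rewrite ler_pdivlMr// mul1r -b2 ler_sqr// nnegrE ltW// (lt_le_trans b0).
  apply: ge0_subset_integral => //; [exact: mk|by move=> t _; rewrite lee_fin min_kernel_ge0|].
  by move=> t; rewrite /= !in_itv/= andbT => /andP[bt _]; exact: lt_le_trans bt.
have -> : `]0%R, +oo[%classic = `]0%R, b] `|` `]b, +oo[ :> set R.
  apply/seteqP; split => t /=; rewrite !in_itv/= !andbT.
    by move=> ->; rewrite /=; have [?|?] := leP t b; [left|right].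
  by move=> [/andP[]//|]; exact: lt_trans.
rewrite ge0_integral_setU//; last 3 first.
- exact: mk.
- by move=> t _; rewrite lee_fin min_kernel_ge0.
- rewrite disj_set2E; apply/eqP/seteqP; split => // t /=; rewrite !in_itv/= andbT.
  by move=> [/andP[_ tb]]; rewrite ltNge tb.
rewrite mulrDl EFinD; apply: leeD.
- apply: (@le_trans _ _ (\int[mu]_(t in `]0%R, b]) ((a^-1)%:E * (t `^ (1 - z *+ 2))%:E) : \bar R)%E).
    apply: ge0_le_integral_nonmeasurable => t; first by move=> _; rewrite lee_fin min_kernel_ge0.
    rewrite /= in_itv/= => /andP[t0 _]; rewrite lee_fin /min_kernel.
    apply: (@le_trans _ _ (t `^ (- z *+ 2 - 1) * (t ^+ 2 / a))).
      by rewrite ler_wpM2l ?powR_ge0// ge_min lexx orbT.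
    rewrite mulrA mulrC -powR_mulrn ?(ltW t0)// -powRD; last by rewrite (gt_eqF t0) implybT.
    by have -> : - z *+ 2 - 1 + 2 = 1 - z *+ 2 by ring.
  rewrite ge0_integralZl_EFin//; last 3 first.
  + by move=> t _; rewrite lee_fin powR_ge0.
  + by apply/measurable_EFinP; apply: measurable_funTS; exact: measurable_powR.
  + by rewrite invr_ge0 ltW.
  have p2 : 1 - z *+ 2 + 1 = (1 - z) *+ 2 by ring.
  apply: (@le_trans _ _ ((a^-1)%:E * (b `^ (1 - z *+ 2 + 1) / (1 - z *+ 2 + 1))%:E)%E).
    apply: lee_wpmul2l; first by rewrite lee_fin invr_ge0 ltW.
    by apply: integral_powR0_le => //; rewrite p2.
  rewrite p2 -EFinM lee_fin.
  have -> : b `^ ((1 - z) *+ 2) = a * a `^ (- z).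
    rewrite -baz -[X in X * _]b2 -powR_mulrn ?ltW// -powRD; last by rewrite (gt_eqF b0) implybT.
    by congr powR; ring.
  rewrite le_eqVlt; apply/orP; left; apply/eqP; field.
  by rewrite (gt_eqF a0) subr_eq0 (gt_eqF z1).
- apply: (@le_trans _ _ (\int[mu]_(t in `[b, +oo[) (t `^ (- z *+ 2 - 1))%:E : \bar R)%E).
    apply: (@le_trans _ _ (\int[mu]_(t in `]b, +oo[) (t `^ (- z *+ 2 - 1))%:E : \bar R)%E).
      apply: ge0_le_integral_nonmeasurable => t; first by move=> _; rewrite lee_fin min_kernel_ge0.
      by move=> _; rewrite lee_fin /min_kernel ler_piMr ?powR_ge0// ge_min lexx.
    apply: ge0_subset_integral => //.
    + by apply/measurable_EFinP; apply: measurable_funTS; exact: measurable_powR.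
    + by move=> t _; rewrite lee_fin powR_ge0.
    + by move=> t /=; rewrite !in_itv/= !andbT; exact: ltW.
  apply: le_trans (integral_powRy_le _ b0) _; rewrite p1 mulNrn ?oppr_lt0//.
  by rewrite opprK -mulNrn baz mulrC.
Qed.
End PowerIntegrals.

(** * The K-functional *)

Section KFunctional.
Context {dsp : measure_display} {T : measurableType dsp} {R : realType}.
Context {mu : {measure set T -> \bar R}} {Om : set T}.
Context {phi : nat -> T -> R} {lam : nat -> R}.
Hypothesis mOm : measurable Om.
Hypothesis Lphi : forall j, L2 mu Om (phi j).
Hypothesis ophi : forall i j, L2ip mu Om (phi i) (phi j) = (i == j)%:R.
Hypothesis lam0 : forall j, 0 < lam j.
Local Notation ip := (L2ip mu Om).
Local Notation psq := (power_sqnorm mu Om phi lam).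
Let siL : semi_inner (L2 mu Om) ip := semi_inner_L2 mOm.

(** Both cases of the theorem are instances: s = 0 for L_2 and the RKHS, s = 1 for the RKHS and the
    range of T. *)
Variables (A K : set (T -> R)) (NA NK : (T -> R) -> R) (s : R).
Hypothesis AL2 : A `<=` L2 mu Om.
Hypothesis A_norm : forall f, A f -> 0 <= NA f /\ ((NA f ^+ 2)%:E = psq s f)%E.
Hypothesis A_sub : forall f g, A f -> A g -> A (f - g).
Hypothesis KA : K `<=` A.
Hypothesis K_norm : forall f, K f -> 0 <= NK f /\ ((NK f ^+ 2)%:E = psq (s + 1) f)%E.
Hypothesis K_psum : forall b n, K (psum phi b n).

Local Notation w := (fun j => lam j `^ (- s)).
Let m t j : R := Num.min 1 (t ^+ 2 / lam j).

(** Minimising (f_j - v_j)^2 + x v_j^2 over v_j, with x = t^2 / lam_j, gives f_j^2 x / (1 + x), and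
    x / (1 + x) lies between half of min(1, x) and min(1, x). *)
Definition K_sum t f := (\sum_(j <oo) (w j * ip f (phi j) ^+ 2 * m t j)%:E)%E.

Let m01 t j : 0 <= m t j <= 1.
Proof.
by rewrite /m ge_min lexx andbT le_min ler01 divr_ge0 ?sqr_ge0// ltW.
Qed.
Let m0 t j : 0 <= m t j. Proof. by have /andP[] := m01 t j. Qed.
Let m1 t j : m t j <= 1. Proof. by have /andP[] := m01 t j. Qed.

Let w0 j : 0 <= w j. Proof. exact: powR_ge0. Qed.

Let wS j : lam j `^ (- (s + 1)) = w j / lam j.
Proof.
rewrite opprD powRD; last by rewrite (gt_eqF (lam0 j)) implybT.
by rewrite powR_inv1// ltW.
Qed.

Lemma sum_sqr_norms t u v : 0 <= t -> A u -> K v ->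
  (((NA u) ^+ 2 + t ^+ 2 * NK v ^+ 2)%:E = \sum_(j <oo)
    (w j * (ip u (phi j) ^+ 2 + t ^+ 2 / lam j * ip v (phi j) ^+ 2))%:E)%E.
Proof.
move=> t0 Au Kv; rewrite EFinD [(t ^+ 2 * _)%:E]EFinM (A_norm Au).2 (K_norm Kv).2 /power_sqnorm.
rewrite -nneseriesZl => [|j _]; last by rewrite lee_fin mulr_ge0 ?powR_ge0 ?sqr_ge0.
rewrite -nneseriesD => [|j _ _|j _ _].
- apply: eq_eseriesr => j _; rewrite -EFinM -EFinD; congr EFin.
  by rewrite !real_normK ?num_real// wS; ring.
- by rewrite lee_fin mulr_ge0 ?powR_ge0 ?sqr_ge0.
- by rewrite -EFinM lee_fin mulr_ge0 ?sqr_ge0// mulr_ge0 ?powR_ge0 ?sqr_ge0.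
Qed.

Lemma K_sum_lty t f : A f -> (K_sum t f < +oo)%E.
Proof.
move=> Af; apply: (@le_lt_trans _ _ ((NA f ^+ 2)%:E)); last exact: ltry.
rewrite (A_norm Af).2; apply: lee_nneseries => [j _ _|j _]; rewrite lee_fin.
  by rewrite mulr_ge0// mulr_ge0// sqr_ge0.
by rewrite real_normK ?num_real// ler_piMr// mulr_ge0// sqr_ge0.
Qed.

Lemma K_sum_ge0 t f : (0 <= K_sum t f)%E.
Proof. by apply: nneseries_ge0 => j _ _; rewrite lee_fin mulr_ge0// mulr_ge0// sqr_ge0. Qed.

Let Kset t f := [set NA (f - v) + t * NK v | v in K].

Lemma Kset_ge0 t f : 0 <= t -> A f -> lbound (Kset t f) 0.
Proof.
move=> t0 Af _ [v Kv <-]; have [+ _] := A_norm (A_sub Af (KA Kv)).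
by have [+ _] := K_norm Kv => h1 h2; rewrite addr_ge0// mulr_ge0.
Qed.

Lemma Kset_neq0 t f : Kset t f !=set0.
Proof. by exists (NA (f - psum phi (fun=> 0) 0) + t * NK (psum phi (fun=> 0) 0)); exists (psum phi (fun=> 0) 0). Qed.

Lemma K_sum_le_K t f : 0 < t -> A f ->
  (K_sum t f <= (2 * K_functional NA K NK t f ^+ 2)%:E)%E.
Proof.
move=> t0 Af; have fin := K_sum_lty t Af.
have fE : K_sum t f = (fine (K_sum t f))%:E by rewrite fineK// ge0_fin_numE// K_sum_ge0.
have f0 : 0 <= fine (K_sum t f) by rewrite fine_ge0// K_sum_ge0.
have f20 : 0 <= fine (K_sum t f) / 2 by rewrite divr_ge0.
suff h : Num.sqrt (fine (K_sum t f) / 2) <= K_functional NA K NK t f.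
  rewrite fE lee_fin mulrC -ler_pdivrMr// -[leLHS]sqr_sqrtr//.
  by rewrite ler_sqr// nnegrE ?sqrtr_ge0// (le_trans _ h)// sqrtr_ge0.
apply: lb_le_inf; first exact: Kset_neq0.
move=> _ [v Kv <-].
have Av := KA Kv; have Afv := A_sub Af Av.
have [N0 _] := A_norm Afv; have [N1 _] := K_norm Kv.
rewrite -ler_sqr ?nnegrE ?sqrtr_ge0 ?addr_ge0 ?mulr_ge0 ?(ltW t0)// sqr_sqrtr//.
apply: (@le_trans _ _ (NA (f - v) ^+ 2 + t ^+ 2 * NK v ^+ 2)); last first.
  by rewrite sqrrD exprMn lerD2r lerDl mulrn_wge0// mulr_ge0// mulr_ge0// ltW.
rewrite ler_pdivrMr// mulrC -lee_fin -fE EFinM (sum_sqr_norms (ltW t0) Afv Kv).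
rewrite -nneseriesZl => [|j _]; last first.
  by rewrite lee_fin mulr_ge0// addr_ge0 ?sqr_ge0// mulr_ge0 ?sqr_ge0// divr_ge0 ?sqr_ge0// ltW.
apply: lee_nneseries => [j _ _|j _]; first by rewrite lee_fin mulr_ge0// mulr_ge0// sqr_ge0.
rewrite -EFinM lee_fin (si_ipBl siL) ?AL2//; try exact: AL2.
set x := ip f _; set y := ip v _.
rewrite -mulrA [leRHS]mulrCA ler_wpM2l//.
have mt : m t j <= t ^+ 2 / lam j by rewrite /m ge_min lexx orbT.
apply: (@le_trans _ _ (2 * (m t j * ((x - y) ^+ 2 + y ^+ 2)))).
  rewrite mulrC [leRHS]mulrCA ler_wpM2l//.
  (* This square is exactly 2 ((x - y)^2 + y^2) - x^2. *)
  have : 0 <= (x - y - y) ^+ 2 by exact: sqr_ge0.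
  by nra.
rewrite ler_wpM2l// mulrDr; apply: lerD; first by rewrite ler_piMl// sqr_ge0.
by rewrite ler_wpM2r// sqr_ge0.
Qed.

Lemma K_le_K_sum t f : 0 < t -> A f ->
  ((K_functional NA K NK t f ^+ 2)%:E <= 2%:E * K_sum t f)%E.
Proof.
move=> t0 Af; have Lf := AL2 Af.
pose c j := w j * ip f (phi j) ^+ 2.
have c0 j : 0 <= c j by rewrite mulr_ge0// sqr_ge0.
have cN : (\sum_(j <oo) (c j)%:E = (NA f ^+ 2)%:E)%E.
  by rewrite (A_norm Af).2; apply: eq_eseriesr => j _; rewrite real_normK ?num_real.
(* Putting coordinate j into v costs the factor t^2 / lam_j, leaving it in f - v costs 1; the
   cheaper choice costs m_j(t). *)
pose b j := if t ^+ 2 <= lam j then ip f (phi j) else 0.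
(* Below n the chosen coordinates attain m_j(t) exactly. From n on everything stays in f - v, which
   costs the tail of the series for [NA f ^+ 2]; it vanishes as n grows. The factor 2 comes from (x
   + y)^2 <= 2 (x^2 + y^2). *)
have hn n : ((K_functional NA K NK t f ^+ 2)%:E <=
    2%:E * (K_sum t f + \sum_(n <= j <oo) (c j)%:E))%E.
  have Kv := K_psum b n; set v := psum phi b n in Kv.
  have Av := KA Kv; have Afv := A_sub Af Av.
  have [N0 _] := A_norm Afv; have [N1 _] := K_norm Kv.
  have Kle : K_functional NA K NK t f <= NA (f - v) + t * NK v.
    apply: ge_inf; last by exists v.
    by exists 0; apply: Kset_ge0 => //; exact: ltW.
  have K0 : 0 <= K_functional NA K NK t f.
    by apply: lb_le_inf; [exact: Kset_neq0|apply: Kset_ge0 => //; exact: ltW].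
  apply: (@le_trans _ _ (2 * (NA (f - v) ^+ 2 + t ^+ 2 * NK v ^+ 2))%:E).
    rewrite lee_fin; apply: (@le_trans _ _ ((NA (f - v) + t * NK v) ^+ 2)).
      by rewrite ler_sqr ?nnegrE// addr_ge0// mulr_ge0// ltW.
    have : 0 <= (NA (f - v) - t * NK v) ^+ 2 by exact: sqr_ge0.
    by rewrite -exprMn; nra.
  rewrite EFinM lee_wpmul2l// (sum_sqr_norms (ltW t0) Afv Kv).
  rewrite (nneseries_split 0 n) => [|j _]; last first.
    by rewrite lee_fin mulr_ge0// addr_ge0 ?sqr_ge0// mulr_ge0 ?sqr_ge0// divr_ge0 ?sqr_ge0// ltW.
  rewrite add0n; apply: leeD.
    rewrite big_mkord sumEFin.
    apply: le_trans (@nneseries_ge_sum R (fun j => c j * m t j) n _); last first.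
      by move=> j; rewrite mulr_ge0.
    rewrite lee_fin; apply: ler_sum => j _.
    rewrite (si_ipBl siL) ?AL2//; try exact: AL2.
    rewrite (si_ip_psum siL) // ltn_ord /c /b /m; case: ifPn => tl.
      rewrite subrr expr0n/= add0r min_r; last by rewrite ler_pdivrMr// mul1r.
      by rewrite le_eqVlt; apply/orP; left; apply/eqP; ring.
    rewrite subr0 expr0n/= mulr0 addr0 min_l ?mulr1//.
    by rewrite ler_pdivlMr// mul1r ltW// ltNge.
  rewrite eseries_cond [leRHS]eseries_cond; apply: lee_nneseries => [j _ _|j /= nj].
    by rewrite lee_fin mulr_ge0// addr_ge0 ?sqr_ge0// mulr_ge0 ?sqr_ge0// divr_ge0 ?sqr_ge0// ltW.
  rewrite lee_fin (si_ipBl siL) ?AL2//; try exact: AL2.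
  by rewrite (si_ip_psum siL)// ltnNge nj/= subr0 expr0n/= mulr0 addr0.
have tail : (\sum_(n <= j <oo) (c j)%:E)%E @[n --> \oo] --> 0%E.
  by apply: nneseries_tail_cvg => [|j _]; rewrite ?lee_fin// cN ltry.
have lim : (2%:E * (K_sum t f + \sum_(n <= j <oo) (c j)%:E))%E @[n --> \oo] --> (2%:E * (K_sum t f + 0))%E.
  apply: cvgeZl => //; apply: cvgeD => //; last exact: cvg_cst.
  by rewrite fin_num_adde_defl.
rewrite -[X in (2%:E * X)%E]adde0.
have /cvg_lim <- := lim; last exact: ereal_hausdorff.
by apply: lime_ge; [apply/cvg_ex; eexists; exact: lim|exact: nearW].
Qed.

(** The K-functional is compared with the series [Phi], which is measurable in t and can be
    integrated term by term. The two comparisons with [K_sum] each lose a factor 2, hence c / 2 and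
    2 C. *)
Lemma interp_sqnorm_equiv z : 0 < z < 1 -> exists c C : R, [/\ 0 < c, 0 < C & forall f, A f ->
  (c%:E * psq (s + z) f <= interp_sqnorm NA K NK z f)%E /\
  (interp_sqnorm NA K NK z f <= C%:E * psq (s + z) f)%E].
Proof.
move=> z01; have [c [C [c0 C0 cC]]] := integral_min_kernel z01.
exists (c / 2), (2 * C); split; [exact: divr_gt0|exact: mulr_gt0|].
move=> f Af; pose a j := w j * ip f (phi j) ^+ 2.
have a0 j : 0 <= a j by rewrite mulr_ge0// sqr_ge0.
pose Phi t := (\sum_(j <oo) (a j * min_kernel z (lam j) t)%:E)%E.
have Phi0 t : (0 <= Phi t)%E.
  by apply: nneseries_ge0 => j _ _; rewrite lee_fin mulr_ge0// min_kernel_ge0.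
have a0E j : (0 <= (a j)%:E)%E by rewrite lee_fin.
have PhiE t : (Phi t = (t `^ (- z *+ 2 - 1))%:E * K_sum t f)%E.
  rewrite /K_sum -nneseriesZl => [|j _]; last by rewrite lee_fin mulr_ge0// mulr_ge0// sqr_ge0.
  by apply: eq_eseriesr => j _; rewrite -EFinM /min_kernel /a -/(m t j) mulrCA.
have mk j (D : set R) : measurable_fun D (fun t => (a j * min_kernel z (lam j) t)%:E : \bar R).
  by apply/measurable_EFinP; apply: measurable_funTS; apply: measurable_funM => //; exact: measurable_min_kernel.
have mPhi (D : set R) : measurable_fun D Phi.
  apply: ge0_emeasurable_sum => // j t _ _.
  by rewrite lee_fin mulr_ge0// min_kernel_ge0.
have iPhi : (\int[@lebesgue_measure R]_(t in `]0%R, +oo[) Phi t =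
    \sum_(j <oo) ((a j)%:E * \int[@lebesgue_measure R]_(t in `]0%R, +oo[) (min_kernel z (lam j) t)%:E))%E.
  rewrite /Phi integral_nneseries//; last 2 first.
    by move=> j; exact: mk.
    by move=> j t _; rewrite lee_fin mulr_ge0// min_kernel_ge0.
  apply: eq_eseriesr => j _; rewrite -ge0_integralZl_EFin//.
  - by move=> t _; rewrite lee_fin min_kernel_ge0.
  - by apply/measurable_EFinP; apply: measurable_funTS; exact: measurable_min_kernel.
have psqE : (psq (s + z) f = \sum_(j <oo) (a j * lam j `^ (- z))%:E)%E.
  apply: eq_eseriesr => j _; rewrite real_normK ?num_real// opprD powRD.
    by congr EFin; rewrite /a; ring.
  by rewrite (gt_eqF (lam0 j)) implybT.
have lo : (c%:E * psq (s + z) f <= \int[@lebesgue_measure R]_(t in `]0%R, +oo[) Phi t)%E.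
  rewrite iPhi psqE -nneseriesZl => [|j _]; last by rewrite lee_fin mulr_ge0// powR_ge0.
  apply: lee_nneseries => [j _ _|j _].
    by rewrite -EFinM lee_fin mulr_ge0 ?(ltW c0)// mulr_ge0// powR_ge0.
  have /andP[h _] := cC _ (lam0 j).
  by apply: le_trans (lee_wpmul2l (a0E j) h); rewrite -!EFinM lee_fin mulrCA.
have hi : (\int[@lebesgue_measure R]_(t in `]0%R, +oo[) Phi t <= C%:E * psq (s + z) f)%E.
  rewrite iPhi psqE -nneseriesZl => [|j _]; last by rewrite lee_fin mulr_ge0// powR_ge0.
  apply: lee_nneseries => [j _ _|j _].
    by apply: mule_ge0; rewrite ?lee_fin// integral_ge0// => t _; rewrite lee_fin min_kernel_ge0.
  have /andP[_ h] := cC _ (lam0 j).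
  by apply: (le_trans (lee_wpmul2l (a0E j) h)); rewrite -!EFinM lee_fin mulrCA.
have gE t : 0 < t -> ((`|t `^ (- z) * K_functional NA K NK t f| ^+ 2 / t)%:E =
    (t `^ (- z *+ 2 - 1))%:E * (K_functional NA K NK t f ^+ 2)%:E)%E.
  move=> t0; rewrite real_normK ?num_real// -EFinM exprMn mulrAC; congr (_ * _)%:E.
  rewrite -powR_mulrn ?powR_ge0// -powRrM -powR_inv1 ?ltW// -powRD; last by rewrite (gt_eqF t0) implybT.
  by congr powR; ring.
split.
- rewrite mulrC EFinM -muleA.
  apply: (@le_trans _ _ ((2^-1)%:E * \int[@lebesgue_measure R]_(t in `]0%R, +oo[) Phi t)%E).
    by apply: lee_wpmul2l => //; rewrite lee_fin invr_ge0.
  rewrite -ge0_integralZl_EFin//; last exact: mPhi.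
  apply: ge0_le_integral_nonmeasurable => t; first by move=> _; rewrite mule_ge0// lee_fin invr_ge0.
  rewrite /= in_itv/= andbT => t0; rewrite gE// PhiE muleCA lee_wpmul2l ?lee_fin ?powR_ge0//.
  apply: (le_trans (lee_wpmul2l _ (K_sum_le_K t0 Af))); first by rewrite lee_fin invr_ge0.
  by rewrite -EFinM lee_fin mulKf.
- rewrite EFinM -muleA.
  apply: (@le_trans _ _ (2%:E * \int[@lebesgue_measure R]_(t in `]0%R, +oo[) Phi t)%E); last first.
    by apply: lee_wpmul2l.
  rewrite -ge0_integralZl_EFin//; last exact: mPhi.
  apply: ge0_le_integral_nonmeasurable => t.
    by rewrite /= in_itv/= andbT => t0; rewrite lee_fin divr_ge0 ?sqr_ge0// ltW.
  rewrite /= in_itv/= andbT => t0; rewrite gE// PhiE muleCA lee_wpmul2l ?lee_fin ?powR_ge0//.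
  exact: K_le_K_sum.
Qed.

Lemma power_interp_equiv z : 0 < z < 1 -> power_space mu Om phi lam (s + z) `<=` A ->
  equal_with_equivalent_norms
    (power_space mu Om phi lam (s + z)) (power_norm mu Om phi lam (s + z))
    (interp_space A NA K NK z) (interp_norm NA K NK z).
Proof.
move=> z01 PA; have [c [C [c0 C0 cC]]] := interp_sqnorm_equiv z01.
have p0 f : (0 <= psq (s + z) f)%E.
  by apply: nneseries_ge0 => j _ _; rewrite lee_fin mulr_ge0 ?powR_ge0 ?exprn_ge0.
have i0 f : (0 <= interp_sqnorm NA K NK z f)%E.
  apply: integral_ge0 => t; rewrite /= in_itv/= andbT => t0.
  by rewrite lee_fin divr_ge0 ?exprn_ge0 ?(ltW t0).
split.
  apply/seteqP; split => f.
    move=> Pf; have Af := PA _ Pf; split => //; apply: (le_lt_trans (cC f Af).2).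
    by rewrite lte_mul_pinfty ?lee_fin ?(ltW C0)//; exact: Pf.2.
  move=> [Af fin]; split; first exact: AL2.
  have := le_lt_trans (cC f Af).1 fin.
  by case: (psq (s + z) f) (p0 f) => [r _ _|_|//]; rewrite ?ltry// gt0_muley// lte_fin.
exists (Num.sqrt c), (Num.sqrt C); split; [by rewrite sqrtr_gt0..|].
move=> f Pf; have Af := PA _ Pf; have [lo hi] := cC f Af.
have pfin : psq (s + z) f \is a fin_num by rewrite ge0_fin_numE//; exact: Pf.2.
have ifin : interp_sqnorm NA K NK z f \is a fin_num.
  rewrite ge0_fin_numE//; apply: (le_lt_trans hi).
  by rewrite lte_mul_pinfty ?lee_fin ?(ltW C0)//; exact: Pf.2.
rewrite /power_norm /interp_norm -!sqrtrM ?(ltW c0) ?(ltW C0)//.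
by split; apply: ler_wsqrtr; rewrite -lee_fin EFinM !fineK.
Qed.
End KFunctional.

(** * The two interpolation identities *)

Section PowerInterpolation.
Context {dsp : measure_display} {T : measurableType dsp} {R : realType}.
Context {mu : {measure set T -> \bar R}} {Om : set T} {k : T -> T -> R}.
Context {H : set (T -> R)} {ip : (T -> R) -> (T -> R) -> R}.
Context {phi : nat -> T -> R} {lam : nat -> R}.
Hypothesis mOm : measurable Om.
Hypothesis rkhs : is_RKHS Om k H ip.
Hypothesis mer : mercer mu Om k H ip phi lam.

Lemma power_space_le s t f : s <= t ->
  power_space mu Om phi lam t f -> power_space mu Om phi lam s f.
Proof.
move=> st [Lf fin]; split => //; have [C C0 h] := power_sqnorm_le mOm mer st.
by apply: le_lt_trans (h f) _; rewrite lte_mul_pinfty// lee_fin ltW.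
Qed.

Lemma rkhs_spaceE : rkhs_space mu Om H = power_space mu Om phi lam 1.
Proof.
apply/seteqP; split => f [Lf h]; split => //; first by apply/(rkhs_power mOm mer rkhs Lf).1.
by have [_] := ((rkhs_power mOm mer rkhs Lf).1).2 h.
Qed.

Lemma power_interpolation_L2_rkhs (theta : R) : 0 < theta < 1 ->
  equal_with_equivalent_norms
    (power_space mu Om phi lam theta) (power_norm mu Om phi lam theta)
    (interp_space (L2 mu Om) (L2norm mu)
       (rkhs_space mu Om H) (rkhs_norm mu H ip) theta)
    (interp_norm (L2norm mu)
       (rkhs_space mu Om H) (rkhs_norm mu H ip) theta).
Proof.
move=> th; rewrite -[theta in power_space _ _ _ _ theta]add0r -[theta in power_norm _ _ _ _ theta]add0r.
apply: (power_interp_equiv mOm (mercer_phi_L2 mer) (mercer_phi_orthonormal mer)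
  (mercer_lam_gt0 mer)) => //.
- by move=> f Lf; exact: (L2_power mOm mer Lf).
- by move=> f g Lf Lg; exact: (siB (semi_inner_L2 mOm)).
- by move=> f [].
- by move=> f Hf; rewrite add0r; exact: (rkhs_power mOm mer rkhs Hf.1).2.
- exact: (rkhs_psum mOm mer rkhs).
- by move=> f [].
Qed.

Lemma power_interpolation_rkhs_range (theta : R) : 1 < theta < 2 ->
  equal_with_equivalent_norms
    (power_space mu Om phi lam theta) (power_norm mu Om phi lam theta)
    (interp_space (rkhs_space mu Om H) (rkhs_norm mu H ip)
       (range_space mu Om k) (range_norm mu Om k) (theta - 1))
    (interp_norm (rkhs_norm mu H ip)
       (range_space mu Om k) (range_norm mu Om k) (theta - 1)).
Proof.
move=> /andP[t1 t2]; have tE : 1 + (theta - 1) = theta by rewrite addrC subrK.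
rewrite -[theta in power_space _ _ _ _ theta]tE -[theta in power_norm _ _ _ _ theta]tE.
apply: (power_interp_equiv mOm (mercer_phi_L2 mer) (mercer_phi_orthonormal mer)
  (mercer_lam_gt0 mer)) => //.
- by move=> f [].
- by move=> f Hf; exact: (rkhs_power mOm mer rkhs Hf.1).2.
- move=> f g [Lf [f' Hf ff']] [Lg [g' Hg gg']]; split; first exact: (siB (semi_inner_L2 mOm)).
  exists (f' - g'); first exact: (siB (semi_inner_RKHS rkhs)).
  by apply: filterS2 ff' gg' => x fx gx _; rewrite -[LHS]/(f x - g x) fx// gx.
(* The range lies in the RKHS by coefficients: a finite sum with weights lam^-2 forces a finite one
   with weights lam^-1. *)
- move=> f Rf; rewrite rkhs_spaceE; apply: (@power_space_le 1 2); first by rewrite ler1n.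
  by split; [exact: Rf.1|rewrite -(range_power mOm mer Rf).2 ltry].
- by move=> f Rf; have := range_power mOm mer Rf.
- exact: (range_psum mOm mer).
- by rewrite subr_gt0 t1 ltrBlDr.
- rewrite tE rkhs_spaceE => f; apply: power_space_le; exact: ltW.
Qed.
End PowerInterpolation.

Theorem lemma14 (R : realType) (d : nat) (Om : set (Rd R d))
    (k : Rd R d -> Rd R d -> R)
    (H : set (Rd R d -> R)) (ip : (Rd R d -> R) -> (Rd R d -> R) -> R)
    (phi : nat -> Rd R d -> R) (lam : nat -> R) (theta : R) :
  let mu := lebesgue_Rd R d in
  measurable Om ->
  psd_kernel Om k ->
  is_RKHS Om k H ip ->
  mercer mu Om k H ip phi lam ->
  (0 < theta < 1 ->
    equal_with_equivalent_norms
      (power_space mu Om phi lam theta) (power_norm mu Om phi lam theta)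
      (interp_space (L2 mu Om) (L2norm mu)
         (rkhs_space mu Om H) (rkhs_norm mu H ip) theta)
      (interp_norm (L2norm mu)
         (rkhs_space mu Om H) (rkhs_norm mu H ip) theta)) /\
  (1 < theta < 2 ->
    equal_with_equivalent_norms
      (power_space mu Om phi lam theta) (power_norm mu Om phi lam theta)
      (interp_space (rkhs_space mu Om H) (rkhs_norm mu H ip)
         (range_space mu Om k) (range_norm mu Om k) (theta - 1))
      (interp_norm (rkhs_norm mu H ip)
         (range_space mu Om k) (range_norm mu Om k) (theta - 1))).
Proof.
move=> mu mOm _ rkhs mer.
split.
- have h := power_interpolation_L2_rkhs mOm rkhs mer; exact: h.
- have h := power_interpolation_rkhs_range mOm rkhs mer; exact: h.
Qed.
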